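(* Consider the discretised first-price auction with complete information with $N\ge 2$ buyers, positive integer valuations $v_1\ge v_2\ge\cdots\ge v_N$, and $v_1\ge 2$. Define the subset $B_1'\subseteq B_1$ of bids of buyer $1$ by: (1) if $v_1\in\{v_2,v_2+1\}$, then $B_1'=\{b_1\in B_1 : b_1<v_2-2\}$; (2) if $v_1>v_2+1$, then $B_1'=\{b_1\in B_1 : b_1\neq v_2\}$. Then $B_1'$ may be eliminated via an additively separable potential depending only on the mixed strategies of buyers $1$ and $2$; that is, there exist Lipschitz-differentiable tangential functions $h_1:\Delta(B_1)\to\mathbb{R}$ and $h_2:\Delta(B_2)\to\mathbb{R}$ such that for every mixed-strategy profile $x\in\prod_{i}\Delta(B_i)$, $$\langle\nabla h_1(x_1),\nabla_1u_1(x)\rangle+\langle\nabla h_2(x_2),\nabla_2u_2(x)\rangle\ \ge\ \sum_{b_1\in B_1'}x_1(b_1).$$ As a consequence, if buyers $1$ and $2$ each implement online gradient ascent for $T$ periods with non-increasing step sizes $(\eta_{it})_{t=1}^T$ ($i=1,2$, possibly different for the two buyers) satisfying $1/\eta_{iT}=o(T)$ and $\sum_{t=1}^T\eta_{it}=o(T)$, while the remaining buyers choose their mixed strategies $x_i^t\in\Delta(B_i)$ arbitrarily, then in time-average buyer $1$ chooses a bid outside $\{v_2-2,v_2-1,v_2\}$ with probability $o(1)$ as $T\to\infty$, i.e. $$\frac1T\sum_{t=1}^T\ \sum_{b_1\in B_1\setminus\{v_2-2,v_2-1,v_2\}}x_1^t(b_1)=o(1).$$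
   Context: First-price auction: buyer $i$ has bid set $B_i=\{0,1,\dots,v_i-1\}$. For a bid profile $b\in\prod_iB_i$, $u_i(b)=\frac{v_i-b_i}{|\arg\max_jb_j|}$ if $i\in\arg\max_jb_j$, and $u_i(b)=0$ otherwise. Here $\Delta(B_i)=\{x_i\in\mathbb{R}^{B_i}:x_i\ge0,\ \sum_{b_i}x_i(b_i)=1\}$, and $u_i$ is extended multilinearly to mixed profiles by $u_i(x)=\sum_b\big(\prod_jx_j(b_j)\big)u_i(b)$. $\nabla_iu_i(x)\in\mathbb{R}^{B_i}$ is the gradient in the coordinates $x_i$, with entries $\partial u_i(x)/\partial x_i(b_i)=\sum_{b_{-i}}\big(\prod_{j\ne i}x_j(b_j)\big)u_i(b)$. A differentiable function $h$ on $\Delta(B_i)$ is understood as given by a continuously differentiable function on a neighbourhood in $\mathbb{R}^{B_i}$, and $\nabla h$ is its gradient. It is Lipschitz-differentiable if $\nabla h$ is Lipschitz continuous on $\Delta(B_i)$. It is tangential if $\nabla h(x_i)$ lies in the tangent cone of $\Delta(B_i)$ at $x_i$ for every $x_i\in\Delta(B_i)$; equivalently $\sum_{b}\nabla h(x_i)_b=0$, and $\nabla h(x_i)_b\ge0$ whenever $x_i(b)=0$. Online gradient ascent for buyer $i$: from an arbitrary $x_i^1\in\Delta(B_i)$, $x_i^{t+1}=\Pi_{\Delta(B_i)}[x_i^t+\eta_{it}\nabla_iu_i(x^t)]$, where $\Pi_C$ is Euclidean projection onto $C$. Step sizes are positive and may depend on the horizon $T$. *)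

(* Defs.v *)
From HB Require Import structures.
From mathcomp Require Import all_boot all_order all_algebra.
From mathcomp Require Import all_classical all_reals all_analysis.
Set Implicit Arguments.
Unset Strict Implicit.
Unset Printing Implicit Defensive.
Import Order.TTheory GRing.Theory Num.Theory.
Import numFieldNormedType.Exports.
Local Open Scope classical_set_scope.
Local Open Scope ring_scope.

Section Euclidean.
Variables (R : realType) (n : nat).
Implicit Types (x y p d : 'rV[R]_n) (C : set 'rV[R]_n) (h : 'rV[R]_n -> R).

Definition dot x y : R := \sum_k x 0 k * y 0 k.

(* The library norm on ['rV_n] is the sup norm, so the Euclidean norm needed
   for the projection is defined separately. *)
Definition enorm x : R := Num.sqrt (dot x x).

(* [p] is the Euclidean projection of [y] onto [C]: for [C] closed, convex and
   nonempty, exactly one such [p] exists. *)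
Definition is_euclidean_projection C y p : Prop :=
  C p /\ forall q, C q -> enorm (y - p) <= enorm (y - q).

Definition grad h x : 'rV[R]_n := \row_k 'D_(delta_mx 0 k) h x.

Definition simplex : set 'rV[R]_n :=
  [set x | (forall k, 0 <= x 0 k) /\ \sum_k x 0 k = 1].

Definition tangent_cone C x : set 'rV[R]_n :=
  closure [set d | exists l : R, exists2 y, 0 <= l /\ C y & d = l *: (y - x)].

(* [h] is a total function, but only its values near the simplex matter. *)
Definition C1_near_simplex h : Prop :=
  exists U : set 'rV[R]_n, [/\ open U, simplex `<=` U,
    forall x, U x -> differentiable h x &
    forall x, U x -> {for x, continuous (grad h)}].

(* Lipschitz continuity does not depend on the choice between the sup norm
   and the Euclidean norm. *)
Definition lipschitz_differentiable h : Prop :=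
  C1_near_simplex h /\ [lipschitz grad h x | x in simplex].

Definition tangential h : Prop :=
  forall x, simplex x -> tangent_cone simplex x (grad h x).

Lemma tangent_cone_simplexP x d : simplex x ->
  tangent_cone simplex x d <->
  \sum_k d 0 k = 0 /\ forall k, x 0 k = 0 -> 0 <= d 0 k.
Proof.
move=> [x0 x1]; split.
- pose B : set 'rV[R]_n := (fun e : 'rV[R]_n => \sum_k e 0 k) @^-1` [set t : R | t = 0] `&`
    \bigcap_(k in [set k | x 0 k = 0])
      ((fun e : 'rV[R]_n => e 0 k) @^-1` [set t : R | 0 <= t]).
  have sum_cont : continuous (fun e : 'rV[R]_n => \sum_k e 0 k).
    by apply: (continuous_big add_continuous) => k _; exact: coord_continuous.
  have clB : closed B.
    apply: closedI.
      apply: preimage_closed; last exact: closed_eq.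
      by move=> y _; exact: sum_cont.
    apply: closed_bigI => k _.
    apply: preimage_closed; last exact: closed_ge.
    by move=> y _; exact: coord_continuous.
  suff : tangent_cone simplex x `<=` B by move=> /[apply].
  rewrite [X in _ `<=` X](closure_id _).1 //; apply: closureS.
  move=> _ [l [y [l0 [y0 y1]] ->]]; split=> [|k xk] /=.
    under eq_bigr do rewrite !mxE.
    by rewrite -mulr_sumr sumrB y1 x1 subrr mulr0.
  by rewrite !mxE xk subr0 mulr_ge0.
- move=> [d0 dx]; apply: subset_closure.
  pose l : R := 1 + \sum_(k | 0 < x 0 k) `|d 0 k| / x 0 k.
  have s0 (P : pred 'I_n) : 0 <= \sum_(k | P k && (0 < x 0 k)) `|d 0 k| / x 0 k.
    by apply: sumr_ge0 => k /andP[_ xk]; rewrite divr_ge0 // ltW.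
  have l_gt0 : 0 < l by rewrite ltr_wpDr //; exact: (s0 predT).
  exists l, (x + l^-1 *: d); last first.
    by rewrite addrC addKr scalerA divff ?gt_eqF // scale1r.
  split; first exact: ltW.
  split=> [k|]; last first.
    under eq_bigr do rewrite !mxE.
    by rewrite big_split /= -mulr_sumr d0 mulr0 addr0.
  rewrite !mxE; have := x0 k; rewrite le_eqVlt => /predU1P[xk|xk].
    by rewrite -xk add0r mulr_ge0 ?dx // invr_ge0 ltW.
  rewrite -lerBlDr sub0r -mulrN ler_pdivrMl //.
  rewrite -ler_pdivrMr //; apply: (@le_trans _ _ (`|d 0 k| / x 0 k)).
    by rewrite ler_pM2r ?invr_gt0 // -normrN ler_norm.
  rewrite /l (bigD1 k) //= addrCA lerDl addr_ge0 //.
  by under eq_bigl do rewrite andbC; exact: s0.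
Qed.

End Euclidean.

Arguments simplex {R n}.

Section FirstPriceAuction.
Variables (R : realType) (N : nat) (v : 'I_N -> nat).

(* Buyer [i]'s bid set {0, ..., v i - 1} is ['I_(v i)], and vectors in R^(B_i)
   are ['rV[R]_(v i)]. *)
Definition bid_profile : finType := {dffun forall i : 'I_N, 'I_(v i)}.

Definition profile : Type := forall i : 'I_N, 'rV[R]_(v i).

Definition mixed_profile (x : profile) : Prop := forall i, simplex (x i).

Definition winners (b : bid_profile) : {set 'I_N} :=
  [set i | [forall j, (b j <= b i)%N]].

Definition payoff (i : 'I_N) (b : bid_profile) : R :=
  if i \in winners b then ((v i)%:R - (b i)%:R) / #|winners b|%:R else 0.

Definition utility (i : 'I_N) (x : profile) : R :=
  \sum_(b : bid_profile) (\prod_j x j 0 (b j)) * payoff i b.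

(* [eqtype.dfwith x y] is the profile [x] with buyer [i]'s component replaced by [y]. *)
Definition own_grad (i : 'I_N) (x : profile) : 'rV[R]_(v i) :=
  grad (fun y : 'rV[R]_(v i) => utility i (eqtype.dfwith x y)) (x i).

Lemma own_gradE (i : 'I_N) (x : profile) (k : 'I_(v i)) :
  own_grad i x 0 k =
  \sum_(b : bid_profile | b i == k) (\prod_(j | j != i) x j 0 (b j)) * payoff i b.
Proof.
pose c (b : bid_profile) : R := (\prod_(j | j != i) x j 0 (b j)) * payoff i b.
have uE (y : 'rV[R]_(v i)) :
    utility i (eqtype.dfwith x y) = \sum_(b : bid_profile) y 0 (b i) * c b.
  apply: eq_bigr => b _; rewrite (bigD1 i) //= dfwith_in -mulrA; congr (_ * (_ * _)).
  by apply: eq_bigr => j ji; rewrite dfwith_out // eq_sym.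
rewrite /own_grad /grad mxE.
rewrite (_ : (fun y => _) = (fun y : 'rV[R]_(v i) =>
  \sum_(b : bid_profile) y 0 (b i) * c b)); last exact/funext.
apply: cvg_lim => //; apply: cvg_near_cst; near=> h.
have h0 : h != 0 by near: h; exact: nbhs_dnbhs_neq.
rewrite /= -sumrB [RHS]big_mkcond /= scaler_sumr; apply: eq_bigr => b _.
rewrite !mxE eqxx /= -mulrBl addrK eq_sym scalerAl.
by case: eqP => _; rewrite ?mulr1 ?mulr0 ?mul0r //= /GRing.scale /= ?mulVf ?mul1r ?mulr0 ?mul0r.
Unshelve. all: by end_near. Qed.

(* [x t] is the profile played in period [t]; periods are numbered 1, ..., T. *)
Definition online_gradient_ascent (i : 'I_N) (T : nat) (eta : nat -> R)
    (x : nat -> profile) : Prop :=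
  forall t, (1 <= t < T)%N ->
    is_euclidean_projection simplex (x t i + eta t *: own_grad i (x t)) (x t.+1 i).

End FirstPriceAuction.

Section StepSizes.
Variable R : realType.

(* [eta T t] is the step size used in period [t] when the horizon is [T]. *)
Definition admissible_step_sizes (eta : nat -> nat -> R) : Prop :=
  [/\ forall T t, (1 <= t <= T)%N -> 0 < eta T t,
      forall T s t, (1 <= s <= t)%N -> (t <= T)%N -> eta T t <= eta T s,
      (fun T => (eta T T)^-1%R : R) =o_\oo (fun T => T%:R : R) &
      (fun T => \sum_(1 <= t < T.+1) eta T t : R) =o_\oo (fun T => T%:R : R)].

End StepSizes.

Definition buyer1 (N : nat) (hN : (2 <= N)%N) : 'I_N := Ordinal (ltnW hN).
Definition buyer2 (N : nat) (hN : (2 <= N)%N) : 'I_N := Ordinal hN.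

(* The set B_1' as a predicate on bids, for v1 >= v2; written with
   [b + 2 < v2] because subtraction on [nat] is truncated. *)
Definition eliminated (v1 v2 b : nat) : bool :=
  if (v1 == v2) || (v1 == v2 + 1)%N then (b + 2 < v2)%N else b != v2.

(* b \in {v2 - 2, v2 - 1, v2} over the integers *)
Definition near_second_value (v2 b : nat) : bool :=
  [|| b + 2 == v2, b + 1 == v2 | b == v2]%N.

(* Main.v *)
Require Import Defs.
From HB Require Import structures.
From mathcomp Require Import all_boot all_order all_algebra.
From mathcomp Require Import all_classical all_reals all_analysis.
From mathcomp Require Import ring lra zify.
Set Implicit Arguments.
Unset Strict Implicit.
Unset Printing Implicit Defensive.
Import Order.TTheory GRing.Theory Num.Theory.
Import numFieldNormedType.Exports.
Local Open Scope classical_set_scope.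
Local Open Scope ring_scope.

(* A tangential field moves probability between bids, and pairing it with the
   buyer's gradient gives the expected payoff gain of these moves. At level b,
   both buyers move b uniformly to the higher bids. If the rival bids above b,
   the move gains, since b wins nothing; if the best rival bid is b, the move
   is neutral, since b wins at most half of v - b, which is the average of what
   the higher bids win. To break this tie, buyer 1 also moves b to b+1, at rate
   max(0, x(b) - x(b+1)); linear fields do not suffice (for two buyers with
   v1 = v2 = 3, none works). Losses occur only against rival bids below b or
   when a lower bid of one's own is moved, and a large multiple of the lower
   levels absorbs them, so bids are eliminated from the bottom up. If
   v1 > v2 + 1, moving all of buyer 1's mass to v2 finally eliminates v2 - 1
   and the bids above v2.

   For the regret bound, let p be the projection of x + eta g. The residual
   x + eta g - p is nonpositive on the tangent cone at p, hence
   eta <grad h(x), g> <= h(p) - h(x) + O(eta^2); divide by eta and sum by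
   parts. *)

(** * Smooth potentials and tangential fields *)

Section SmoothPotentials.
Variables (R : realType) (n : nat).
Implicit Types (x y d a : 'rV[R]_n) (h : 'rV[R]_n -> R) (G : 'rV[R]_n -> 'rV[R]_n).

Lemma coord_le_norm x k : `|x 0 k| <= `|x|.
Proof.
by rewrite [leRHS]/Num.Def.normr /= mx_normrE; apply: (le_bigmax _ _ (0, k)).
Qed.

Lemma norm_le_coord x (C : R) : 0 <= C -> (forall k, `|x 0 k| <= C) -> `|x| <= C.
Proof.
move=> C0 xC; rewrite [leLHS]/Num.Def.normr /= mx_normrE.
by apply: bigmax_le => // -[i k] _ /=; rewrite ord1.
Qed.

Lemma dotC x y : dot x y = dot y x.
Proof. by apply: eq_bigr => k _; rewrite mulrC. Qed.

Lemma dotDr x y d : dot x (y + d) = dot x y + dot x d.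
Proof. by rewrite -big_split /=; apply: eq_bigr => k _; rewrite mxE mulrDr. Qed.

Lemma dotZr (c : R) x y : dot x (c *: y) = c * dot x y.
Proof. by rewrite mulr_sumr; apply: eq_bigr => k _; rewrite mxE mulrCA. Qed.

Lemma dotNr x y : dot x (- y) = - dot x y.
Proof. by rewrite -scaleN1r dotZr mulN1r. Qed.

Lemma dotBr x y d : dot x (y - d) = dot x y - dot x d.
Proof. by rewrite dotDr dotNr. Qed.

Lemma dotDl x y d : dot (x + y) d = dot x d + dot y d.
Proof. by rewrite dotC dotDr !(dotC d). Qed.

Lemma dotZl (c : R) x y : dot (c *: x) y = c * dot x y.
Proof. by rewrite dotC dotZr dotC. Qed.

Lemma dotNl x y : dot (- x) y = - dot x y.
Proof. by rewrite dotC dotNr dotC. Qed.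

Lemma dot0l x : dot 0 x = 0.
Proof. by rewrite -(scale0r x) dotZl mul0r. Qed.

Lemma dotBl x y d : dot (x - y) d = dot x d - dot y d.
Proof. by rewrite dotDl dotNl. Qed.

Lemma dot_delta x k : dot x (delta_mx 0 k) = x 0 k.
Proof.
rewrite /dot (bigD1 k) //= mxE !eqxx mulr1 big1 ?addr0 // => j jk.
by rewrite mxE (negbTE jk) andbF mulr0.
Qed.

Lemma ler_norm_dot x y : `|dot x y| <= n%:R * `|x| * `|y|.
Proof.
apply: le_trans (ler_norm_sum _ _ _) _.
rewrite -mulrA mulr_natl -[X in _ *+ X]card_ord -sumr_const.
by apply: ler_sum => k _; rewrite normrM ler_pM // coord_le_norm.
Qed.

Lemma sqr_norm_le_dot x : `|x| ^+ 2 <= dot x x.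
Proof.
have d0 : 0 <= dot x x by apply: sumr_ge0 => k _; rewrite -expr2 sqr_ge0.
rewrite -ler_sqrt ?sqrtr_sqr // ?normr_id.
rewrite norm_le_coord ?sqrtr_ge0 // => k.
rewrite -sqrtr_sqr ler_sqrt ?sqr_ge0 //.
rewrite /dot (bigD1 k) //= expr2 lerDl.
by apply: sumr_ge0 => j _; rewrite -expr2 sqr_ge0.
Qed.

(* The remainder bound pins down [G] as the gradient of [h], and is all that
   the analysis of gradient ascent uses. *)
Definition smooth h G : Prop := exists2 L : R, 0 <= L & forall x y,
  `|G y - G x| <= L * `|y - x| /\
  `|h y - h x - dot (G x) (y - x)| <= L * `|y - x| ^+ 2.

Lemma smoothD h1 G1 h2 G2 : smooth h1 G1 -> smooth h2 G2 ->
  smooth (fun x => h1 x + h2 x) (fun x => G1 x + G2 x).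
Proof.
move=> [L1 L10 H1] [L2 L20 H2]; exists (L1 + L2); first exact: addr_ge0.
move=> x y; have [a1 b1] := H1 x y; have [a2 b2] := H2 x y; split.
  by rewrite opprD addrACA mulrDl (le_trans (ler_normD _ _)) // lerD.
have -> : h1 y + h2 y - (h1 x + h2 x) - dot (G1 x + G2 x) (y - x) =
  (h1 y - h1 x - dot (G1 x) (y - x)) + (h2 y - h2 x - dot (G2 x) (y - x)).
  by rewrite dotDl; ring.
by rewrite mulrDl (le_trans (ler_normD _ _)) // lerD.
Qed.

Lemma smoothZ (c : R) h G : smooth h G ->
  smooth (fun x => c * h x) (fun x => c *: G x).
Proof.
move=> [L L0 H]; exists (`|c| * L); first exact: mulr_ge0.
move=> x y; have [a b] := H x y; split.
  by rewrite -scalerBr normrZ -mulrA ler_wpM2l.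
by rewrite dotZl -!mulrBr normrM -mulrA ler_wpM2l.
Qed.

Lemma smooth0 : smooth (fun=> 0) (fun=> 0).
Proof.
exists 0 => // x y; rewrite subrr normr0 !mul0r subrr; split => //.
by rewrite /dot big1 ?subrr ?normr0 // => k _; rewrite mxE mul0r.
Qed.

Lemma smooth_sum (I : Type) (r : seq I) (P : pred I) hh GG :
  (forall i, P i -> smooth (hh i) (GG i)) ->
  smooth (fun x => \sum_(i <- r | P i) hh i x) (fun x => \sum_(i <- r | P i) GG i x).
Proof.
move=> H; elim: r => [|i r IH].
  rewrite (_ : (fun x => _) = fun=> 0); last by apply/funext => x; rewrite big_nil.
  rewrite (_ : (fun x => \sum_(_ <- _ | _) GG _ _) = fun=> 0) ?smooth0 //.
    exact: smooth0.
  by apply/funext => x; rewrite big_nil.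
case Pi : (P i).
  rewrite (_ : (fun x => _) = fun x => hh i x + \sum_(i <- r | P i) hh i x); last first.
    by apply/funext => x; rewrite big_cons Pi.
  rewrite (_ : (fun x => \sum_(_ <- _ | _) GG _ _) =
      fun x => GG i x + \sum_(i <- r | P i) GG i x).
    by apply: smoothD => //; exact: H.
  by apply/funext => x; rewrite big_cons Pi.
rewrite (_ : (fun x => _) = fun x => \sum_(i <- r | P i) hh i x); last first.
  by apply/funext => x; rewrite big_cons Pi.
rewrite (_ : (fun x => \sum_(_ <- _ | _) GG _ _) =
  fun x => \sum_(i <- r | P i) GG i x) //.
by apply/funext => x; rewrite big_cons Pi.
Qed.

(** All potentials below are sums of multiples of functions of one affine form, so only one-variable
    estimates remain to be checked. [M] is a Lipschitz constant of the form for the sup norm. *)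
Lemma smooth_ridge (f f' : R -> R) (c : R) a :
  (forall s t, `|f' t - f' s| <= `|t - s|) ->
  (forall s t, `|f t - f s - f' s * (t - s)| <= `|t - s| ^+ 2) ->
  smooth (fun x => f (c + dot a x)) (fun x => f' (c + dot a x) *: a).
Proof.
move=> f'L fT; pose M := n%:R * `|a|.
have M0 : 0 <= M by rewrite mulr_ge0.
have dM x y : `|c + dot a y - (c + dot a x)| <= M * `|y - x|.
  by rewrite opprD addrACA subrr add0r -dotBr ler_norm_dot.
exists (M ^+ 2 + M * `|a|); first by rewrite addr_ge0 ?sqr_ge0 ?mulr_ge0.
move=> x y; split.
  rewrite -scalerBl normrZ mulrDl ler_wpDl ?mulr_ge0 ?sqr_ge0 //.
  rewrite -mulrA mulrCA mulrC ler_wpM2l //.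
  exact: le_trans (f'L _ _) (dM _ _).
rewrite dotZl dotBr.
have -> : dot a y - dot a x = c + dot a y - (c + dot a x) by ring.
apply: le_trans (fT _ _) _.
rewrite mulrDl ler_wpDr ?mulr_ge0 ?sqr_ge0 // -exprMn.
by rewrite lerXn2r // ?nnegrE ?mulr_ge0.
Qed.

Lemma smooth_sqr (c : R) a :
  smooth (fun x => (c + dot a x) ^+ 2 / 2) (fun x => (c + dot a x) *: a).
Proof.
apply: (@smooth_ridge (fun t => t ^+ 2 / 2) id) => s t //.
rewrite (_ : _ - _ = (t - s) ^+ 2 / 2); last by field.
rewrite -normrX normrM [X in _ * X]ger0_norm ?invr_ge0 //.
by rewrite ler_pdivrMr // ler_peMr // ler1n.
Qed.

(** Half the squared positive part has the positive part as derivative, which is 1-Lipschitz though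
    not differentiable at 0. This is what admits a nonlinear field. *)
Lemma smooth_pos_sqr (c : R) a :
  smooth (fun x => Num.max 0 (c + dot a x) ^+ 2 / 2)
    (fun x => Num.max 0 (c + dot a x) *: a).
Proof.
apply: (@smooth_ridge (fun t => Num.max 0 t ^+ 2 / 2) (fun t => Num.max 0 t)) => s t.
  have [s0|s0] := lerP s 0; have [t0|t0] := lerP t 0;
    rewrite ?subrr ?normr0 //; have := ler_norm (t - s); rewrite ler_norml;
    have := ler_norm (s - t); rewrite distrC => *; lra.
have [s0|s0] := lerP s 0; have [t0|t0] := lerP t 0;
  rewrite real_normK ?num_real // ler_norml;
  have := sqr_ge0 s; have := sqr_ge0 t; have := sqr_ge0 (t - s) => ? ? ?; apply/andP; split; nra.
Qed.

Lemma lipschitz_bound_continuous (V W : normedModType R) (f : V -> W) (L : R) :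
  (forall x y : V, `|f y - f x| <= L * `|y - x|) -> continuous f.
Proof.
move=> fL x; apply/cvgrPdist_le => e e0; near=> y.
rewrite distrC (le_trans (fL x y)) //.
apply: (@le_trans _ _ ((`|L| + 1) * `|y - x|)).
  by rewrite ler_wpM2r // (le_trans (ler_norm _)) // lerDl.
rewrite mulrC -ler_pdivlMr ?ltr_wpDl // distrC.
by near: y; apply: cvgr_dist_le => //; rewrite divr_gt0 // ltr_wpDl.
Unshelve. all: by end_near. Qed.

Lemma dot_continuous a : continuous (dot a).
Proof.
apply: (@lipschitz_bound_continuous _ _ _ (n%:R * `|a|)) => x y.
by rewrite -dotBr ler_norm_dot.
Qed.

(** The quadratic remainder is [o(d)], and a differential is unique. *)
Lemma smooth_diff h G x : smooth h G ->
  differentiable h x /\ forall d, 'd h x d = dot (G x) d.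
Proof.
move=> [L L0 H].
have lin : linear (dot (G x)) by move=> c u w; rewrite dotDr dotZr.
pose ld : {linear 'rV[R]_n -> R} :=
  HB.pack (dot (G x)) (GRing.isLinear.Build _ _ _ _ _ lin).
have ldc : continuous ld by exact: dot_continuous.
have E : forall e : R, 0 < e -> \forall d \near (0 : 'rV[R]_n),
    `|(h \o shift x - (cst (h x) + ld)) d| <= e * `|d|.
  move=> e e0; near=> d.
  have -> : (h \o shift x - (cst (h x) + ld)) d = h (d + x) - h x - dot (G x) d.
    by rewrite -[LHS]/(h (d + x) - (h x + dot (G x) d)) opprD addrA.
  have [_ ] := H x (d + x); rewrite addrK => /le_trans; apply.
  rewrite expr2 mulrA ler_wpM2r //.
  rewrite (@le_trans _ _ ((L + 1) * `|d|)) ?ler_wpM2r ?lerDl //.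
  rewrite mulrC -ler_pdivlMr ?ltr_wpDl //.
  by near: d; apply: cvgr0_norm_le => //; rewrite divr_gt0 // ltr_wpDl.
move/(@eqaddoP R 'rV[R]_n R 'rV[R]_n) : E => E.
have dE := @diff_unique R 'rV[R]_n R h ld x ldc E; split; last by move=> d; rewrite dE.
by apply/diff_locallyP; rewrite dE.
Unshelve. all: by end_near. Qed.

Lemma smooth_grad h G : smooth h G -> grad h = G.
Proof.
move=> hG; apply/funext => x; apply/rowP => k; rewrite mxE.
by have [dh dE] := smooth_diff x hG; rewrite deriveE // dE dot_delta.
Qed.

Lemma smooth_lipschitz_differentiable h G : smooth h G ->
  lipschitz_differentiable h.
Proof.
move=> hG; have gE := smooth_grad hG; split.
  exists setT; split => //; first exact: openT.
    by move=> x _; have [] := smooth_diff x hG.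
  move=> x _; rewrite gE; case: hG => L L0 H.
  by apply: (@lipschitz_bound_continuous _ _ _ L) => y z; have [] := H y z.
rewrite gE; case: hG => L L0 H.
rewrite /lipschitz_on; near=> M => -[x y] _ /=.
rewrite distrC; have [/le_trans + _] := H x y; apply.
by rewrite distrC ler_wpM2r //; near: M; exact: nbhs_pinfty_ge.
Unshelve. all: by end_near. Qed.

Definition tangential_potential h G : Prop :=
  smooth h G /\ forall x, simplex x ->
    \sum_k G x 0 k = 0 /\ forall k, x 0 k = 0 -> 0 <= G x 0 k.

Lemma tangential_potentialD h1 G1 h2 G2 :
  tangential_potential h1 G1 -> tangential_potential h2 G2 ->
  tangential_potential (fun x => h1 x + h2 x) (fun x => G1 x + G2 x).
Proof.
move=> [s1 t1] [s2 t2]; split; first exact: smoothD.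
move=> x xs; have [a1 b1] := t1 x xs; have [a2 b2] := t2 x xs; split=> [|k xk].
  by under eq_bigr do rewrite mxE; rewrite big_split /= a1 a2 addr0.
by rewrite mxE addr_ge0 ?b1 ?b2.
Qed.

Lemma tangential_potentialZ (c : R) h G : 0 <= c -> tangential_potential h G ->
  tangential_potential (fun x => c * h x) (fun x => c *: G x).
Proof.
move=> c0 [s t]; split; first exact: smoothZ.
move=> x xs; have [a b] := t x xs; split=> [|k xk].
  by under eq_bigr do rewrite mxE; rewrite -mulr_sumr a mulr0.
by rewrite mxE mulr_ge0 ?b.
Qed.

Lemma tangential_potential0 : tangential_potential (fun=> 0) (fun=> 0).
Proof.
split=> [|x _]; first exact: smooth0.
by split=> [|k _]; rewrite ?mxE // big1 // => k _; rewrite mxE.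
Qed.

Lemma tangential_potential_tangential h G : tangential_potential h G -> tangential h.
Proof.
move=> [s t] x xs; apply/(tangent_cone_simplexP _ xs).
by rewrite (smooth_grad s); exact: t.
Qed.

End SmoothPotentials.

(** * Payoffs under mixed profiles *)

Section Expectation.
Variables (R : realType) (N : nat) (v : 'I_N -> nat).
Implicit Types (x : profile R v) (b : bid_profile v) (i : 'I_N).

Lemma sum_profile_prod (F : forall i, 'I_(v i) -> R) :
  \sum_(b : bid_profile v) \prod_i F i (b i) = \prod_i \sum_k F i k.
Proof.
pose Ff i : {ffun 'I_(v i) -> R} := [ffun k => F i k].
transitivity (\sum_(t : fprod (fun i => 'I_(v i))) \prod_(i in 'I_N) Ff i (t i)).
  rewrite (reindex (@dffun_of_fprod _ (fun i => 'I_(v i)))); last first.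
    exact/onW_bij/dffun_of_fprod_bij.
  by apply: eq_bigr => t _; apply: eq_bigr => i _; rewrite !ffunE.
rewrite (@big_fprod _ _ _ _ _ _ _ Ff).
(* Tagged bids give all buyers a common codomain, so the usual distributivity law applies; [untag 0]
   puts the value 0 on bids carrying another buyer's tag. *)
rewrite -(bigA_distr_big_dep _ (fun i => untag 0 (Ff i))).
apply: eq_bigr => i _.
rewrite -[LHS](big_tag (fun i => Ff i)).
by apply: eq_bigr => k _; rewrite ffunE.
Qed.

Definition expect x (f : bid_profile v -> R) : R :=
  \sum_(b : bid_profile v) (\prod_j x j 0 (b j)) * f b.

Lemma expect_marginal x i (f : nat -> R) : mixed_profile x ->
  expect x (fun b => f (b i)) = \sum_k x i 0 k * f k.
Proof.
move=> xs.
pose F j (l : 'I_(v j)) := x j 0 l * (if j == i then f l else 1).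
have -> : expect x (fun b => f (b i)) = \sum_(b : bid_profile v) \prod_j F j (b j).
  apply: eq_bigr => b _; rewrite /F big_split /=; congr (_ * _).
  by rewrite (bigD1 i) //= eqxx big1 ?mulr1 // => j /negbTE ->.
rewrite sum_profile_prod (bigD1 i) //= /F eqxx [X in _ * X]big1 ?mulr1 // => j /negbTE ji.
by under eq_bigr do rewrite ji mulr1; have [_] := xs j.
Qed.

Lemma expect_const x (c : R) : mixed_profile x -> expect x (fun=> c) = c.
Proof.
move=> xs; rewrite /expect -mulr_suml (sum_profile_prod (fun j k => x j 0 k)) big1 ?mul1r // => j _.
by have [_] := xs j.
Qed.

Lemma ler_expect x f g : mixed_profile x -> (forall b, f b <= g b) ->
  expect x f <= expect x g.
Proof.
move=> xs fg; apply: ler_sum => b _; apply: ler_wpM2l; last exact: fg.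
by apply: prodr_ge0 => j _; have [+ _] := xs j; exact.
Qed.

Lemma expectD x f g : expect x (fun b => f b + g b) = expect x f + expect x g.
Proof. by rewrite -big_split /=; apply: eq_bigr => b _; rewrite mulrDr. Qed.

Lemma expectZ x (c : R) f : expect x (fun b => c * f b) = c * expect x f.
Proof. by rewrite mulr_sumr; apply: eq_bigr => b _; rewrite mulrCA. Qed.

Lemma expectB x f g : expect x (fun b => f b - g b) = expect x f - expect x g.
Proof. by rewrite -sumrB; apply: eq_bigr => b _; rewrite mulrBr. Qed.

Definition rebid b i (k : 'I_(v i)) : bid_profile v :=
  [ffun j => eqtype.dfwith b k j].

Lemma rebid_in b i (k : 'I_(v i)) : rebid b k i = k.
Proof. by rewrite ffunE dfwith_in. Qed.

Lemma rebid_out b i (k : 'I_(v i)) j : j != i -> rebid b k j = b j.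
Proof. by move=> ji; rewrite ffunE dfwith_out // eq_sym. Qed.

Lemma rebidK b i (k : 'I_(v i)) : rebid (rebid b k) (b i) = b.
Proof.
apply/ffunP => j; have [->|ji] := eqVneq j i; first by rewrite rebid_in.
by rewrite !rebid_out.
Qed.

(** The gradient ignores buyer [i]'s own bid, whose weights sum to 1, so that bid can be averaged
    back in. Gains can then be bounded profile by profile. *)
Lemma dot_own_grad x i (G : 'rV[R]_(v i)) : mixed_profile x ->
  dot G (own_grad i x) =
  expect x (fun b => \sum_k G 0 k * payoff R i (rebid b k)).
Proof.
move=> xs; rewrite /expect.
under [RHS]eq_bigr do rewrite mulr_sumr.
rewrite exchange_big /=; apply: eq_bigr => k _; rewrite own_gradE.
under [RHS]eq_bigr do rewrite mulrCA.
rewrite -mulr_sumr; congr (_ * _).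
rewrite [RHS](partition_big (fun b : bid_profile v => b i) predT) //=.
have H (l : 'I_(v i)) : \sum_(b : bid_profile v | b i == l)
     \prod_j x j 0 (b j) * payoff R i (rebid b k) =
   x i 0 l * \sum_(b : bid_profile v | b i == k)
     (\prod_(j | j != i) x j 0 (b j)) * payoff R i b.
  rewrite mulr_sumr.
  (* Profiles with own bid [k] and profiles with own bid [l] correspond by overwriting that bid,
     with the rival bids unchanged. *)
  rewrite (reindex_onto (fun b => rebid b l) (fun b => rebid b k)) /=; last first.
    by move=> b /eqP <-; rewrite rebidK.
  apply: eq_big => b.
    rewrite rebid_in eqxx /=; apply/eqP/eqP => [<-|<-]; first by rewrite rebid_in.
    exact: rebidK.
  rewrite rebid_in eqxx /= => /eqP bk.
  rewrite (bigD1 i) //= rebid_in -!mulrA bk.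
  congr (_ * (_ * _)); apply: eq_bigr => j ji.
  by rewrite rebid_out.
under [RHS]eq_bigr do rewrite H.
by rewrite -mulr_suml; have [_ ->] := xs i; rewrite mul1r.
Qed.
End Expectation.

(** * Three tangential fields: rising above a level, pushing to one bid, aiming at one bid *)

Section Fields.
Variables (R : realType) (n : nat).
Implicit Types (x u : 'rV[R]_n) (b c k : 'I_n).

Definition tangential_field (G : 'rV[R]_n -> 'rV[R]_n) : Prop :=
  exists h, tangential_potential h G.

Lemma tangential_fieldD G1 G2 : tangential_field G1 -> tangential_field G2 ->
  tangential_field (fun x => G1 x + G2 x).
Proof. by move=> [h1 H1] [h2 H2]; eexists; exact: tangential_potentialD H1 H2. Qed.

Lemma tangential_fieldZ (c : R) G : 0 <= c -> tangential_field G ->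
  tangential_field (fun x => c *: G x).
Proof. by move=> c0 [h H]; eexists; exact: tangential_potentialZ c0 H. Qed.

Lemma tangential_field0 : tangential_field (fun=> 0).
Proof. by eexists; exact: tangential_potential0. Qed.

Lemma dot_delta_l k u : dot (delta_mx 0 k) u = u 0 k.
Proof. by rewrite dotC dot_delta. Qed.

(* On the simplex [1 - \sum_(j | b < j) x 0 j] is the mass on the bids up to [b],
   but only in this form is the field the gradient of a function on 'rV_n. *)
Definition rise b x : 'rV[R]_n :=
  \row_k (if (b < k)%N then 1 - \sum_(j < n | (b < j)%N) x 0 j
          else - (#|[pred k : 'I_n | (b < k)%N]|%:R * x 0 k)).

Lemma sum_split_ord b (F : 'I_n -> R) :
  \sum_k F k = \sum_(k < n | (k <= b)%N) F k + \sum_(k < n | (b < k)%N) F k.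
Proof.
by rewrite (bigID (fun k : 'I_n => (k <= b)%N)) /=; under [X in _ + X]eq_bigl do rewrite -ltnNge.
Qed.

(** This is the form in which gains are read off: every bid up to [b] sends mass to each bid above
    [b], at a rate equal to its own mass. *)
Lemma dot_rise b x u : simplex x -> dot (rise b x) u =
  \sum_(j < n | (j <= b)%N) x 0 j * \sum_(k < n | (b < k)%N) (u 0 k - u 0 j).
Proof.
move=> [_ x1]; rewrite /dot (sum_split_ord b).
have xb : 1 - \sum_(j < n | (b < j)%N) x 0 j = \sum_(j < n | (j <= b)%N) x 0 j.
  by rewrite -x1 (sum_split_ord b) addrK.
under eq_bigr => k kb do rewrite mxE ltnNge kb /=.
under [X in _ + X]eq_bigr => k kb do rewrite mxE kb xb mulr_suml.
rewrite [X in _ + X]exchange_big -big_split /=; apply: eq_bigr => j jb.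
rewrite sumrB mulrBr -mulr_sumr sumr_const -mulr_natl; ring.
Qed.

Lemma tangential_field_rise b : tangential_field (rise b).
Proof.
(* The potential is minus half the square of 1 minus the mass above [b], minus [m / 2] times the sum
   of the squared masses up to [b]. *)
pose a : 'rV[R]_n := \row_k - (b < k)%N%:R.
pose m : R := #|[pred k : 'I_n | (b < k)%N]|%:R.
exists (fun x => -1 * ((1 + dot a x) ^+ 2 / 2) +
  \sum_(j < n | (j <= b)%N) - m * ((0 + dot (delta_mx 0 j) x) ^+ 2 / 2)); split.
  have := smoothD (smoothZ (-1) (smooth_sqr 1 a))
    (@smooth_sum R n _ (index_enum 'I_n) (fun j => (j <= b)%N) _ _ (fun j _ =>
    smoothZ (- m) (smooth_sqr 0 (delta_mx 0 j)))).
  congr smooth; apply/funext => x; apply/rowP => k; rewrite !mxE summxE.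
  have -> : 1 + dot a x = 1 - \sum_(j < n | (b < j)%N) x 0 j.
    rewrite /dot (sum_split_ord b) big1 ?add0r => [|j jb]; last first.
      by rewrite mxE ltnNge jb oppr0 mul0r.
    by rewrite -sumrN; congr (_ + _); apply: eq_bigr => j jb; rewrite mxE jb mulN1r.
  have eq0 (j : 'I_n) : j != k -> (- m *: ((0 + dot (delta_mx 0 j) x) *: delta_mx 0 j)) 0 k = 0.
    by move=> jk; rewrite !mxE [k == j]eq_sym (negbTE jk) andbF !mulr0.
  case: (ltnP b k) => bk.
    rewrite [X in _ + X]big1 ?addr0 => [|j jb]; first by rewrite !mulN1r mulrN mulr1 opprK.
    by apply: eq0; apply: contraL jb => /eqP ->; rewrite -ltnNge.
  rewrite [X in _ + X](bigD1 k) //= [X in _ + (_ + X)]big1 => [|j /andP[_ jk]]; last exact: eq0.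
  by rewrite !mxE !eqxx dot_delta_l /=; ring.
move=> x xs; split=> [|k xk].
  (* The coordinate sum is the pairing with a constant vector, all of whose differences vanish. *)
  have := dot_rise b (const_mx 1) xs.
  rewrite [LHS](_ : _ = \sum_k rise b x 0 k); last first.
    by apply: eq_bigr => k _; rewrite [const_mx _ _ _]mxE mulr1.
  move=> ->; rewrite big1 // => j _; rewrite big1 ?mulr0 // => k _.
  by rewrite !mxE subrr.
have [x0 x1] := xs; rewrite mxE; case: ifP => _; last by rewrite xk mulr0 oppr0.
rewrite -x1 (sum_split_ord b) addrK sumr_ge0 //.
Qed.

(** The positive part stops the flow when [b] carries no mass, which is what tangency asks; the
    potential is minus half its square. *)
Definition push b c x : 'rV[R]_n :=
  Num.max 0 (x 0 b - x 0 c) *: (delta_mx 0 c - delta_mx 0 b).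

Lemma dot_push b c x u :
  dot (push b c x) u = Num.max 0 (x 0 b - x 0 c) * (u 0 c - u 0 b).
Proof. by rewrite dotZl dotBl !dot_delta_l. Qed.

Lemma tangential_field_push b c : b != c -> tangential_field (push b c).
Proof.
move=> bc; have [d dE] : exists d : 'rV[R]_n, d = delta_mx 0 b - delta_mx 0 c by eexists.
exists (fun x => -1 * (Num.max 0 (0 + dot d x) ^+ 2 / 2)); split.
  have := smoothZ (-1) (smooth_pos_sqr 0 d); congr smooth; apply/funext => x.
  by rewrite /push scaleN1r add0r dE dotBl !dot_delta_l -scalerN opprB.
move=> x [x0 _]; split=> [|k xk].
  under eq_bigr do rewrite !mxE !eqxx /=.
  rewrite -mulr_sumr sumrB (bigD1 c) //= eqxx big1 => [|j /negbTE ->] //.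
  rewrite addr0 (bigD1 b) //= eqxx big1 => [|j /negbTE ->] //.
  by rewrite addr0 subrr mulr0.
rewrite !mxE !eqxx /=; have [kb|kb] := eqVneq k b; last first.
  by rewrite subr0 mulr_ge0 // le_max lexx.
by rewrite -kb xk sub0r (max_idPl _) ?mul0r // oppr_le0.
Qed.

(** The gradient of minus half the squared Euclidean distance to the pure bid [c]. *)
Definition aim c x : 'rV[R]_n := delta_mx 0 c - x.

Lemma dot_aim c x u : simplex x ->
  dot (aim c x) u = \sum_k x 0 k * (u 0 c - u 0 k).
Proof.
move=> [_ x1]; rewrite dotBl dot_delta_l; under eq_bigr do rewrite mulrBr.
by rewrite sumrB -mulr_suml x1 mul1r.
Qed.

Lemma tangential_field_aim c : tangential_field (aim c).
Proof.
exists (fun x => \sum_k -1 * ((- (k == c)%:R + dot (delta_mx 0 k) x) ^+ 2 / 2)); split.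
  have := @smooth_sum R n _ (index_enum 'I_n) predT _ _ (fun k _ =>
    smoothZ (-1) (smooth_sqr (- (k == c)%:R) (delta_mx 0 k))).
  congr smooth; apply/funext => x; apply/rowP => k; rewrite !mxE summxE.
  rewrite (bigD1 k) //= big1 => [|j jk]; last first.
    by rewrite !mxE [k == j]eq_sym (negbTE jk) andbF !mulr0.
  by rewrite !mxE !eqxx dot_delta_l addr0 /= mulr1; ring.
move=> x [x0 x1]; split=> [|k xk].
  under eq_bigr do rewrite !mxE eqxx /=.
  by rewrite sumrB x1 (bigD1 c) //= eqxx big1 => [|j /negbTE ->] //; rewrite addr0 subrr.
by rewrite !mxE xk subr0 eqxx /= ler0n.
Qed.

End Fields.

(** * Payoff bounds at a single bid profile *)

Section Payoff.
Variables (R : realType) (N : nat) (v : 'I_N -> nat).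
Implicit Types (b : bid_profile v) (i j : 'I_N).

Lemma winnersP i b : reflect (forall j, (b j <= b i)%N) (i \in winners b).
Proof. by rewrite inE; exact: forallP. Qed.

Lemma payoff_ge0 i b : 0 <= payoff R i b.
Proof.
rewrite /payoff; case: ifP => // _; rewrite divr_ge0 // subr_ge0 ler_nat.
exact/ltnW/ltn_ord.
Qed.

Lemma payoff_le_share i b (m : nat) : (0 < m)%N -> (m <= #|winners b|)%N ->
  payoff R i b <= ((v i)%:R - (b i)%:R) / m%:R.
Proof.
move=> m0 mw; have vb : 0 <= (v i)%:R - (b i)%:R :> R.
  by rewrite subr_ge0 ler_nat; exact/ltnW/ltn_ord.
rewrite /payoff; case: ifP => _; last by rewrite divr_ge0.
by rewrite ler_wpM2l // lef_pV2 ?posrE ?ltr0n ?ler_nat // (leq_trans m0).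
Qed.

Lemma payoff_le i b : payoff R i b <= (v i)%:R - (b i)%:R.
Proof.
have [iw|/negbTE iw] := boolP (i \in winners b).
  have := @payoff_le_share i b 1 isT; rewrite divr1; apply.
  by apply/card_gt0P; exists i.
by rewrite /payoff iw subr_ge0 ler_nat; exact/ltnW/ltn_ord.
Qed.

Lemma payoff_lost i j b : (b i < b j)%N -> payoff R i b = 0.
Proof. by move=> bij; rewrite /payoff; case: winnersP => // /(_ j); rewrite leqNgt bij. Qed.

Lemma payoff_alone i b : (forall j, j != i -> (b j < b i)%N) ->
  payoff R i b = (v i)%:R - (b i)%:R.
Proof.
move=> bi; have -> : payoff R i b = ((v i)%:R - (b i)%:R) / #|winners b|%:R.
  rewrite /payoff; case: winnersP => // -[] j.
  by have [->//|/bi/ltnW] := eqVneq j i.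
suff -> : winners b = [set i]%SET by rewrite cards1 divr1.
apply/finset.setP => j; rewrite finset.in_set1; have [->|ji] := eqVneq j i.
  by apply/winnersP => k; have [->//|/bi/ltnW] := eqVneq k i.
by apply/negbTE; apply/winnersP => /(_ i); rewrite leqNgt bi.
Qed.

(** If [i] wins, then so does [j], and the prize is shared by at least two. *)
Lemma payoff_tied i j b : j != i -> (b i <= b j)%N ->
  payoff R i b <= ((v i)%:R - (b i)%:R) / 2.
Proof.
move=> ji bij; have vb : 0 <= (v i)%:R - (b i)%:R :> R.
  by rewrite subr_ge0 ler_nat; exact/ltnW/ltn_ord.
have [iw|/negbTE iw] := boolP (i \in winners b); last first.
  by rewrite /payoff iw divr_ge0.
rewrite payoff_le_share // -[leqLHS](_ : #|[set j; i]%SET| = 2); last first.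
  by rewrite cards2 ji.
rewrite fintype.subset_leq_card //; apply/fintype.subsetP => k; rewrite !inE => /orP[]/eqP ->.
  by apply/forallP => l; rewrite (leq_trans _ bij) //; move/winnersP: iw; exact.
by apply/forallP; exact/winnersP.
Qed.

(** Bids stay strictly below the value, so the margin is at least 1, and at most [N] buyers share
    it. *)
Lemma payoff_won i b : (forall j, (b j <= b i)%N) -> N%:R^-1 <= payoff R i b.
Proof.
move=> /winnersP iw; rewrite /payoff iw -[leLHS]mul1r ler_pM ?invr_ge0 //.
  by rewrite lerBrDr addrC natr1 ler_nat ltn_ord.
have w0 : (0 < #|winners b|)%N by apply/card_gt0P; exists i.
have wN : (#|winners b| <= N)%N by rewrite -[leqRHS]card_ord max_card.
by rewrite lef_pV2 ?posrE ?ltr0n ?ler_nat // (leq_trans w0).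
Qed.

Lemma sum_above_average (m b : nat) : (b < m)%N ->
  \sum_(k < m | (b < k)%N) (m%:R - k%:R - (m%:R - b%:R) / 2) = 0 :> R.
Proof.
move=> bm.
rewrite -(big_mkord (fun k => (b < k)%N) (fun k => m%:R - k%:R - (m%:R - b%:R) / 2)).
rewrite -(big_nat_widenl _ _ _ xpredT) //.
(* A discrete primitive of the summand that vanishes at both ends of the range, [b.+1] and [m]. *)
pose f (k : nat) : R := (k%:R - b.+1%:R) * (m%:R - k%:R) / 2.
rewrite (@eq_bigr _ _ _ _ _ _ _ (fun k => f k.+1 - f k)); last first.
  by move=> k _; rewrite /f -!(natr1 k) -!(natr1 b); field.
by rewrite telescope_sumr // /f !subrr mul0r mulr0 !mul0r subrr.
Qed.

(* Against a bid at least [b] of another buyer, bidding [b] wins at most half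
   of [v i - b], which is the average of what the higher bids win when nobody
   else bids above [b]. *)
Lemma rise_gain_ge0 i b (k : 'I_(v i)) j : j != i -> (k <= b j)%N ->
  0 <= \sum_(l < v i | (k < l)%N) (payoff R i (rebid b l) - payoff R i (rebid b k)).
Proof.
move=> ji kj.
have [/existsP[l /andP[li kl]]|] := boolP [exists l, (l != i) && (k < b l)%N].
  rewrite (@payoff_lost i l); last by rewrite rebid_in rebid_out.
  by apply: sumr_ge0 => m _; rewrite subr0 payoff_ge0.
move=> /existsPn nk; rewrite -[leLHS](sum_above_average (ltn_ord k)).
apply: ler_sum => l kl; apply: lerB; last first.
  by have := @payoff_tied i j (rebid b k) ji; rewrite rebid_in rebid_out //; exact.
rewrite payoff_alone ?rebid_in // => m mi; rewrite rebid_out //.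
by rewrite (leq_ltn_trans _ kl) // leqNgt; have := nk m; rewrite mi.
Qed.

(** Bid [k] loses to [j], so no move away from it costs anything, and the move to [m] reaches a
    winning bid. *)
Lemma rise_gain_ge i b (k m : 'I_(v i)) j : (k < b j)%N -> j != i -> (k < m)%N ->
  (forall l, l != i -> (b l <= m)%N) ->
  N%:R^-1 <=
  \sum_(l < v i | (k < l)%N) (payoff R i (rebid b l) - payoff R i (rebid b k)).
Proof.
move=> kj ji km bm; rewrite (@payoff_lost i j); last by rewrite rebid_in rebid_out.
under eq_bigr do rewrite subr0.
rewrite (bigD1 m) //= (@le_trans _ _ (payoff R i (rebid b m))) //.
  apply: payoff_won => l; have [->//|li] := eqVneq l i.
  by rewrite rebid_in rebid_out ?bm.
by rewrite lerDl sumr_ge0 // => l _; exact: payoff_ge0.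
Qed.

Lemma payoff_diff_ge i b b' : - (v i)%:R <= payoff R i b - payoff R i b'.
Proof.
rewrite -[leLHS]add0r lerB ?payoff_ge0 // (le_trans (payoff_le _ _)) //.
by rewrite lerBlDr lerDl.
Qed.

End Payoff.

(** * Regret of projected gradient ascent *)

Section GradientAscent.
Variables (R : realType) (n : nat).
Implicit Types (x y p q d g u : 'rV[R]_n).

Lemma projection_variational (C : set 'rV[R]_n) y p q :
  is_euclidean_projection C y p ->
  (forall s : R, 0 < s <= 1 -> C (p + s *: (q - p))) -> dot (y - p) (q - p) <= 0.
Proof.
move=> [_ pmin] Cq; rewrite leNgt; apply/negP.
set D := y - p; set E := q - p => DE.
have EE : 0 <= dot E E by rewrite (le_trans _ (sqr_norm_le_dot E)) ?sqr_ge0.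
have quad (s : R) : 0 < s <= 1 -> 2 * dot D E <= s * dot E E.
  move=> /[dup] /andP[s0 s1] /Cq/pmin; rewrite opprD addrA -/D -/E /enorm.
  rewrite ler_sqrt; last by rewrite (le_trans _ (sqr_norm_le_dot _)) ?sqr_ge0.
  have -> (a b : 'rV[R]_n) : dot (a - s *: b) (a - s *: b) =
      dot a a - s * (2 * dot a b - s * dot b b).
    by rewrite !(dotBl, dotBr, dotZl, dotZr) (dotC b a); ring.
  move=> H.
  by rewrite -(ler_pM2l s0); lra.
(* Instead of letting [s] tend to 0, one value of [s] already contradicts [quad]: it would give
   [2 * dot D E <= s * dot E E], whose right side is at most [dot D E]. *)
have DEE : 0 < dot D E + dot E E by rewrite ltr_wpDr.
have /quad : 0 < dot D E / (dot D E + dot E E) <= 1.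
  by rewrite divr_gt0 //= ler_pdivrMr // mul1r lerDl.
rewrite leNgt => /negP; apply.
rewrite mulrAC ltr_pdivrMr // -subr_gt0.
have -> : 2 * dot D E * (dot D E + dot E E) - dot D E * dot E E =
  2 * dot D E * dot D E + dot D E * dot E E by ring.
by rewrite ltr_wpDr ?mulr_ge0 ?mulr_gt0 // ltW.
Qed.

Lemma simplex_segment p q (s : R) : simplex p -> simplex q -> 0 < s <= 1 ->
  simplex (p + s *: (q - p)).
Proof.
move=> [p0 p1] [q0 q1] /andP[s0 s1]; split=> [k|].
  rewrite !mxE; have -> : p 0 k + s * (q 0 k - p 0 k) = (1 - s) * p 0 k + s * q 0 k by ring.
  by rewrite addr_ge0 // mulr_ge0 ?subr_ge0 // ltW.
under eq_bigr do rewrite !mxE.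
by rewrite big_split /= -mulr_sumr sumrB p1 q1 subrr mulr0 addr0.
Qed.

(** A closed half-space with 0 on its boundary that contains all [q - p] contains their nonnegative
    multiples and the closure of these. *)
Lemma dot_tangent_le0 (C : set 'rV[R]_n) p u d :
  (forall q, C q -> dot u (q - p) <= 0) -> tangent_cone C p d -> dot u d <= 0.
Proof.
move=> uC; pose H := dot u @^-1` [set t : R | t <= 0].
suff : tangent_cone C p `<=` H by move=> /[apply].
have clH : closed H.
  by apply: preimage_closed; [move=> ? _; exact: dot_continuous | exact: closed_le].
rewrite [X in _ `<=` X](closure_id _).1 //; apply: closureS.
move=> _ [l [q [l0 Cq] ->]]; rewrite /H /= dotZr.
by rewrite mulr_ge0_le0 // uC.
Qed.

Lemma simplex_norm_le1 x : simplex x -> `|x| <= 1.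
Proof.
move=> [x0 x1]; apply: norm_le_coord => // k; rewrite ger0_norm //.
by rewrite -x1 (bigD1 k) //= lerDl sumr_ge0.
Qed.

Lemma smooth_bounded h (G : 'rV[R]_n -> 'rV[R]_n) : smooth h G ->
  exists2 H : R, 0 <= H & forall x, simplex x -> `|h x| <= H.
Proof.
move=> [L L0 hG]; exists (`|h 0| + n%:R * `|G 0| + L).
  by rewrite !addr_ge0 ?mulr_ge0.
move=> x /simplex_norm_le1 x1; have [_] := hG 0 x; rewrite subr0 => hx.
have -> : h x = h 0 + dot (G 0) x + (h x - h 0 - dot (G 0) x) by ring.
apply: le_trans (ler_normD _ _) (lerD (le_trans (ler_normD _ _) (lerD _ _)) _) => //.
  by rewrite (le_trans (ler_norm_dot _ _)) // ler_piMr ?mulr_ge0.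
by rewrite (le_trans hx) // ler_piMr // expr_le1.
Qed.

(* With [p] the projection of [x + eta *: g], the residual [x + eta *: g - p]
   is nonpositive on the tangent cone at [p], which contains [G p]; replacing
   [G p] by [G x] costs only [O(eta ^+ 2)], since [p] is within [O(eta)] of [x]. *)
Lemma projected_step h (G : 'rV[R]_n -> 'rV[R]_n) (M : R) :
  0 <= M -> tangential_potential h G ->
  exists2 C : R, 0 <= C & forall x p g (eta : R), 0 < eta -> simplex x -> `|g| <= M ->
    is_euclidean_projection simplex (x + eta *: g) p ->
    eta * dot (G x) g <= h p - h x + C * eta ^+ 2.
Proof.
move=> M0 [[L L0 hG] Gt].
pose K := n%:R * M; have K0 : 0 <= K by rewrite mulr_ge0.
exists (L * K ^+ 2 + n%:R * L * K * M); first by rewrite addr_ge0 ?mulr_ge0 ?sqr_ge0.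
move=> x p g eta e0 xs gM pr; have [ps _] := pr.
have var q : simplex q -> dot (x + eta *: g - p) (q - p) <= 0.
  by move=> qs; apply: projection_variational pr _ => s; exact: simplex_segment.
(* Testing the variational inequality at [x] itself bounds the squared distance by [eta] times a
   pairing of [g] with [x - p]; the factor [n] in [K] comes from using the sup norm. *)
have xpK : `|x - p| <= K * eta.
  have := var x xs; rewrite addrAC dotDl dotZl => H.
  have : `|x - p| ^+ 2 <= (K * eta) * `|x - p|.
    rewrite (le_trans (sqr_norm_le_dot _)) //.
    rewrite (@le_trans _ _ (- (eta * dot g (x - p)))) //; first by lra.
    have dg : - dot g (x - p) <= K * `|x - p|.
      rewrite (le_trans (ler_norm _)) // normrN (le_trans (ler_norm_dot _ _)) //.
      by rewrite ler_wpM2r // /K ler_wpM2l.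
    by have := ler_wpM2l (ltW e0) dg; lra.
  have [->|xp] := eqVneq (x - p) 0; first by rewrite normr0 mulr_ge0 // ltW.
  by rewrite expr2 ler_pM2r // normr_gt0.
have tan : dot (x + eta *: g - p) (G p) <= 0.
  by apply: dot_tangent_le0 var _; apply/tangent_cone_simplexP => //; exact: Gt.
have [Glip _] := hG p x; have [_ hT] := hG p x.
have step1 : eta * dot (G p) g <= h p - h x + L * `|x - p| ^+ 2.
  move: hT; rewrite ler_norml => /andP[_ hT].
  move: tan; rewrite addrAC dotDl dotZl (dotC (x - p)) (dotC g) => tan.
  lra.
have step2 : dot (G x - G p) g <= n%:R * L * K * M * eta.
  rewrite (le_trans (ler_norm _)) // (le_trans (ler_norm_dot _ _)) //.
  rewrite (@le_trans _ _ (n%:R * (L * (K * eta)) * M)) //; last first.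
    by rewrite le_eqVlt; apply/orP; left; apply/eqP; ring.
  rewrite ler_pM ?mulr_ge0 // ler_wpM2l // (le_trans Glip) // ler_wpM2l //.
have step3 : `|x - p| ^+ 2 <= (K * eta) ^+ 2 by rewrite lerXn2r ?nnegrE ?mulr_ge0 // ltW.
have -> : dot (G x) g = dot (G p) g + dot (G x - G p) g by rewrite dotBl; ring.
have := ler_wpM2l L0 step3; have := ler_wpM2l (ltW e0) step2.
rewrite mulrDr; nra.
Qed.

Lemma sum_increments_le (w a : nat -> R) (H : R) (T : nat) : (0 < T)%N ->
  (forall t, (1 <= t <= T)%N -> 0 <= w t) ->
  (forall s t, (1 <= s <= t)%N -> (t <= T)%N -> w s <= w t) ->
  (forall t, (1 <= t <= T)%N -> `|a t| <= H) ->
  \sum_(1 <= t < T) w t * (a t.+1 - a t) <= 2 * H * w T.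
Proof.
move=> T0 w0 wmon aH.
have aH' t : (1 <= t <= T)%N -> - H <= a t <= H by move=> /aH; rewrite ler_norml.
(* Summation by parts as an induction: since [a m + H] is nonnegative, a larger weight only raises
   the bound. *)
suff /(_ T) : forall m, (1 <= m <= T)%N ->
    \sum_(1 <= t < m) w t * (a t.+1 - a t) <= (a m + H) * w m.
  rewrite T0 leqnn => /(_ isT)/le_trans; apply; rewrite ler_wpM2r ?w0 ?T0 ?leqnn //.
  by have /andP[] := aH' T (introT andP (conj T0 (leqnn T))); lra.
elim=> [//|[_ mT|m IH mT]].
  rewrite big_geq // mulr_ge0 ?w0 //.
  by have /andP[] := aH' 1%N mT; lra.
rewrite big_nat_recr //=.
have mT' : (1 <= m.+1 <= T)%N by apply: ltnW.
have wm : w m.+1 <= w m.+2 by apply: wmon => //=.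
have /andP[am _] := aH' _ mT'.
have w2 : 0 <= w m.+2 by apply: w0.
have /andP[am2 _] : - H <= a m.+2 <= H by apply: aH'.
have := IH mT'; move: (\sum_(_ <= _ < _) _) => S.
have am' : 0 <= a m.+1 + H by lra.
have := ler_wpM2l am' wm; nra.
Qed.

End GradientAscent.

Section Regret.
Variables (R : realType) (N : nat) (v : 'I_N -> nat).

Lemma own_grad_le (x : profile R v) i : mixed_profile x -> `|own_grad i x| <= (v i)%:R.
Proof.
move=> xs; apply: norm_le_coord => // k.
rewrite -dot_delta_l dot_own_grad // ler_norml.
have E b : \sum_l (delta_mx 0 k : 'rV[R]_(v i)) 0 l * payoff R i (rebid b l) =
   payoff R i (rebid b k).
  rewrite (bigD1 k) //= mxE !eqxx mul1r big1 ?addr0 // => l /negbTE lk.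
  by rewrite mxE lk andbF mul0r.
rewrite -{1}(expect_const (- _) xs) -{2}(expect_const (v i)%:R xs).
apply/andP; split; apply: ler_expect => // b; rewrite E.
  by rewrite (@le_trans _ _ 0) ?payoff_ge0 // oppr_le0.
by rewrite (le_trans (payoff_le _ _ _)) // lerBlDr lerDl.
Qed.

(** [C] is chosen before the horizon, the step sizes and the play, all of which may vary with [T].
    The sum stops before [T] because the last period is followed by no update. The weights
    [(eta t)^-1] are nondecreasing, so [sum_increments_le] applies. *)
Lemma regret_bound i h G : tangential_potential h G ->
  exists2 C : R, 0 <= C & forall (T : nat) (eta : nat -> R) (x : nat -> profile R v),
    (0 < T)%N -> (forall t, (1 <= t <= T)%N -> 0 < eta t) ->
    (forall s t, (1 <= s <= t)%N -> (t <= T)%N -> eta t <= eta s) ->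
    (forall t, (1 <= t <= T)%N -> mixed_profile (x t)) ->
    online_gradient_ascent i T eta x ->
    \sum_(1 <= t < T) dot (G (x t i)) (own_grad i (x t)) <=
    C * ((eta T)^-1 + \sum_(1 <= t < T.+1) eta t).
Proof.
move=> hG; have [H H0 hH] := smooth_bounded hG.1.
have [C C0 step] := projected_step (ler0n _ (v i)) hG.
exists (2 * H + C); first by rewrite addr_ge0 ?mulr_ge0.
move=> T eta x T0 e0 emon xs oga.
have inT t : (1 <= t < T)%N -> (1 <= t <= T)%N by move=> /andP[-> /ltnW].
have S1 : \sum_(1 <= t < T) (eta t)^-1 * (h (x t.+1 i) - h (x t i)) <=
    2 * H * (eta T)^-1.
  apply: (sum_increments_le (a := fun t => h (x t i))) => // [t tT|s t st tT|t tT].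
  - by rewrite invr_ge0 ltW // e0.
  - have /andP[s1 s2] := st.
    by rewrite lef_pV2 ?posrE ?emon ?e0 ?tT ?s1 ?(leq_trans s2) ?(leq_trans s1).
  - exact/hH/xs.
have eT : 0 < eta T by rewrite e0 // T0 leqnn.
have S2 : \sum_(1 <= t < T) C * eta t <= C * \sum_(1 <= t < T.+1) eta t.
  rewrite -mulr_sumr ler_wpM2l // big_nat_recr //= lerDl ltW //.
have e_ge0 : 0 <= \sum_(1 <= t < T.+1) eta t.
  by rewrite big_nat sumr_ge0 // => t tT; rewrite ltW // e0.
apply: (@le_trans _ _ (\sum_(1 <= t < T)
    ((eta t)^-1 * (h (x t.+1 i) - h (x t i)) + C * eta t))).
  rewrite big_nat [leRHS]big_nat; apply: ler_sum => t tT.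
  have et := e0 t (inT t tT).
  have := step _ _ _ _ et (xs t (inT t tT) i) (own_grad_le i (xs t (inT t tT))) (oga t tT).
  rewrite -ler_pdivlMl // => /le_trans; apply; rewrite le_eqVlt; apply/orP; left.
  by apply/eqP; field; rewrite gt_eqF.
rewrite big_split /= mulrDr !mulrDl.
have := mulr_ge0 C0 (ltW (_ : 0 < (eta T)^-1)); rewrite invr_gt0 => /(_ eT).
have := mulr_ge0 (mulr_ge0 (ler0n R 2) H0) e_ge0.
lra.
Qed.
End Regret.

(** * Elimination of bids *)

Section Prob.
Variables (R : realType) (N : nat) (v : 'I_N -> nat).
Implicit Types (x : profile R v) (b : bid_profile v) (i : 'I_N) (S T : pred nat).

(** Events are predicates on [nat], so that one event makes sense for buyers with different bid
    sets. *)
Definition prob x i S : R := \sum_(k < v i | S k) x i 0 k.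

Lemma probE x i S : prob x i S = \sum_j x i 0 j * (S j)%:R.
Proof.
rewrite /prob big_mkcond; apply: eq_bigr => j _.
by case: (S j); rewrite (mulr1, mulr0).
Qed.

Lemma prob_ge0 x i S : mixed_profile x -> 0 <= prob x i S.
Proof. by move=> xs; apply: sumr_ge0 => k _; have [] := xs i. Qed.

Lemma prob_le x i S T : mixed_profile x -> (forall k, (k < v i)%N -> S k -> T k) ->
  prob x i S <= prob x i T.
Proof.
move=> xs ST; rewrite /prob big_mkcond [leRHS]big_mkcond /=; apply: ler_sum => k _.
by have [x0 _] := xs i; case: ifP => [/(ST _ (ltn_ord k)) ->|_] //; case: ifP.
Qed.

Lemma prob_le1 x i S : mixed_profile x -> prob x i S <= 1.
Proof. by move=> xs; have [_ <-] := xs i; apply: (@prob_le x i S predT). Qed.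

Lemma prob_point x i (k : 'I_(v i)) : prob x i (pred1 (k : nat)) = x i 0 k.
Proof. by rewrite /prob (big_pred1 k). Qed.

Lemma expect_prob x i S : mixed_profile x ->
  expect x (fun b => (S (b i))%:R) = prob x i S.
Proof.
move=> xs; rewrite (@expect_marginal _ _ _ x i (fun k => (S k)%:R)) // /prob [RHS]big_mkcond.
by apply: eq_bigr => k _; case: (S k); rewrite (mulr1, mulr0).
Qed.

Lemma prob_trichotomy x i S (m : nat) :
  prob x i S = prob x i (fun k => S k && (k < m)%N) +
    prob x i (fun k => S k && (k == m)) + prob x i (fun k => S k && (m < k)%N).
Proof.
rewrite /prob (bigID (fun k : 'I_(v i) => (k < m)%N)) /= -addrA; congr (_ + _).
rewrite (bigID (fun k : 'I_(v i) => k == m :> nat)) /=; congr (_ + _);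
  apply: eq_bigl => k; case: (S k) => //=; lia.
Qed.

Lemma eq_prob x i S T : S =1 T -> prob x i S = prob x i T.
Proof. by move=> ST; apply: eq_bigl => k; rewrite ST. Qed.

Lemma prob_ltS x i (m : nat) :
  prob x i (fun k => k < m.+1)%N = prob x i (fun k => k < m)%N + prob x i (pred1 m).
Proof.
rewrite (@prob_trichotomy x i _ m) [X in _ + X]big1 ?addr0; last by move=> k; lia.
by congr (_ + _); apply: eq_prob => k /=; lia.
Qed.

End Prob.

Section Responses.
Variables (R : realType) (N : nat) (v : 'I_N -> nat).
Implicit Types (b : bid_profile v).

(** The pure-profile counterpart of [own_grad]; it depends only on the rival bids in [b]. *)
Definition responses i b : 'rV[R]_(v i) := \row_k payoff R i (rebid b k).

Lemma dot_own_grad_responses (x : profile R v) i (G : 'rV[R]_(v i)) :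
  mixed_profile x ->
  dot G (own_grad i x) = expect x (fun b => dot G (responses i b)).
Proof.
move=> xs; rewrite dot_own_grad //; apply: eq_bigr => b _; congr (_ * _).
by apply: eq_bigr => k _; rewrite mxE.
Qed.

Lemma responses_outbid i j b : j != i -> (v i <= b j)%N -> responses i b = 0.
Proof.
move=> ji vb; apply/rowP => k; rewrite !mxE (@payoff_lost R N v i j) //.
by rewrite rebid_in rebid_out // (leq_trans (ltn_ord k)).
Qed.

(** Isolates the move of bid [k]. Each lower bid also moves to at most [v i] targets, losing at most
    [v i] at each. *)
Lemma dot_rise_responses_ge i b (x : 'rV[R]_(v i)) (k : 'I_(v i)) : simplex x ->
  x 0 k * \sum_(l < v i | (k < l)%N) (payoff R i (rebid b l) - payoff R i (rebid b k))
    - (v i)%:R ^+ 2 * \sum_(j < v i | (j < k)%N) x 0 j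
  <= dot (rise k x) (responses i b).
Proof.
move=> xs; have [x0 _] := xs; rewrite dot_rise // [leRHS](bigD1 k) //=.
have rE l : payoff R i (rebid b l) = responses i b 0 l by rewrite mxE.
under [X in x 0 k * X - _]eq_bigr do rewrite !rE.
rewrite lerD2l [leRHS](eq_bigl (fun j : 'I_(v i) => (j < k)%N)); last first.
  by move=> j; rewrite ltn_neqAle andbC.
rewrite [in leLHS]mulr_sumr -sumrN; apply: ler_sum => j jk.
rewrite mulrC -mulrN ler_wpM2l //.
apply: (@le_trans _ _ (\sum_(l < v i | (k < l)%N) - (v i)%:R)); last first.
  by apply: ler_sum => l _; rewrite !mxE payoff_diff_ge.
rewrite sumrN lerN2 sumr_const expr2 -[X in X <= _]mulr_natl ler_wpM2r //.
by rewrite ler_nat -[leqRHS]card_ord max_card.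
Qed.

Lemma rise_gain_ge_opp i b (k : 'I_(v i)) :
  - (v i)%:R ^+ 2 <=
  \sum_(l < v i | (k < l)%N) (payoff R i (rebid b l) - payoff R i (rebid b k)).
Proof.
apply: (@le_trans _ _ (\sum_(l < v i | (k < l)%N) - (v i)%:R)); last first.
  by apply: ler_sum => l _; rewrite payoff_diff_ge.
rewrite sumrN lerN2 sumr_const expr2 -[X in X <= _]mulr_natl ler_wpM2r //.
by rewrite ler_nat -[leqRHS]card_ord max_card.
Qed.

End Responses.

Section Elimination.
Variables (R : realType) (N : nat) (hN : (2 <= N)%N) (v : 'I_N -> nat).
Hypothesis v_noninc : forall i j : 'I_N, (i <= j)%N -> (v j <= v i)%N.
Implicit Types (b : bid_profile v) (x : profile R v).

Let i1 := buyer1 hN.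
Let i2 := buyer2 hN.
Let v1 := v i1.
Let v2 := v i2.

Let i21 : i2 != i1. Proof. by []. Qed.

Let v21 : (v2 <= v1)%N. Proof. exact: v_noninc. Qed.

Let rival_val j : j != i1 -> (v j <= v2)%N.
Proof.
move=> j1; apply: v_noninc; rewrite lt0n; apply: contra j1 => /eqP j0.
exact/eqP/val_inj.
Qed.

(** Hence, for buyer 1, a bid [v2] wins alone and a bid [v2 - 1] is never outbid. *)
Let rival_lt b j : j != i1 -> (b j < v2)%N.
Proof. by move=> /rival_val; apply: leq_trans; exact: ltn_ord. Qed.

Let N_gt0 : 0 < N%:R :> R. Proof. by rewrite ltr0n ltnW. Qed.

Lemma rise_scaled b i (k : 'I_(v i)) (y : R) : 0 <= y ->
  N%:R^-1 <=
    \sum_(l < v i | (k < l)%N) (payoff R i (rebid b l) - payoff R i (rebid b k)) ->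
  y <= N%:R * (y *
    \sum_(l < v i | (k < l)%N) (payoff R i (rebid b l) - payoff R i (rebid b k))).
Proof.
by move=> y0 H; rewrite mulrCA ler_peMr // -ler_pdivrMl // mulr1.
Qed.

(** * One step of the elimination: from the bids below [m] to the bids up to [m] *)

Section Level.
Variables (m : nat) (m_v2 : (m.+1 < v2)%N) (m_v1 : (m.+2 < v1)%N).

Let k : 'I_v1 := Ordinal (ltnW (ltnW m_v1)).
Let k' : 'I_v1 := Ordinal (ltnW m_v1).
Let l : 'I_v2 := Ordinal (ltnW m_v2).

Definition level1 (p : 'rV[R]_v1) : 'rV[R]_v1 := N%:R *: rise k p + push k k' p.
Definition level2 (q : 'rV[R]_v2) : 'rV[R]_v2 := N%:R *: rise l q.

(** Worst loss per unit of moved mass: the first term is for the scaled [rise], the second for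
    [push], whose rate is at most the mass on [k]. *)
Let C1 : R := N%:R * v1%:R ^+ 2 + v1%:R.
Let C2 : R := N%:R * v2%:R ^+ 2.

Let C1_ge0 : 0 <= C1. Proof. by rewrite addr_ge0 ?mulr_ge0 ?sqr_ge0. Qed.

(** Compare buyer 2's bid with [m]. If it is higher, the factor [N] turns the gain of [rise] into
    the full mass on [k]. If it is equal, [push] gains half its rate, or another rival bids above
    [m] and [rise] gains even more. If it is lower, the loss is charged to [C1]. *)
Lemma level1_gain x b : mixed_profile x ->
  Num.max 0 (x i1 0 k - x i1 0 k') / 2 * (b i2 == m :> nat)%:R
  + x i1 0 k * (m < b i2)%N%:R
  - C1 * prob x i1 (fun j => j < m)%N
  - C1 * x i1 0 k * (b i2 < m)%N%:R
  <= dot (level1 (x i1)) (responses R i1 b).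
Proof.
move=> xs; have [p0 _] := xs i1.
rewrite dotDl dotZl dot_push !mxE.
have := ler_wpM2l (ltW N_gt0) (dot_rise_responses_ge b k (xs i1)).
rewrite -/v1 -/(prob x i1 (fun j => j < m)%N).
set PL := prob x i1 _; have PL0 : 0 <= PL by exact: prob_ge0.
set tau := Num.max _ _.
have tau0 : 0 <= tau by rewrite le_max lexx.
have taup : tau <= x i1 0 k by rewrite ge_max p0 gerBl p0.
have v1PL : 0 <= v1%:R * PL by rewrite mulr_ge0.
set a := \sum_(_ < _ | _) _.
set d := payoff R i1 (rebid b k') - payoff R i1 (rebid b k).
set r := dot _ _.
rewrite mulrBr /C1.
have v2_gt0 : (0 < v2)%N by exact: leq_trans m_v2.
have top : (v2.-1 < v1)%N by rewrite prednK.
have outbid j : j != i1 -> (m < b j)%N -> N%:R^-1 <= a /\ 0 <= d.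
  move=> j1 mj; split.
    apply: (@rise_gain_ge R N v i1 b k (Ordinal top) j) => //=.
      by rewrite -ltnS prednK // ltnW.
    by move=> h h1; rewrite -ltnS prednK ?rival_lt // ltnW // ltnW.
  by rewrite /d (@payoff_lost R N v i1 j (rebid b k)) ?subr0 ?payoff_ge0 // rebid_in rebid_out.
case: (ltngtP (b i2) m) => bm /=; rewrite ?(mulr1n, mulr1, mulr0n, mulr0, addr0, add0r).
- have a_ge : - v1%:R ^+ 2 <= a by exact: rise_gain_ge_opp.
  have d_ge : - v1%:R <= d by exact: payoff_diff_ge.
  have h1 := ler_wpM2l tau0 d_ge.
  have h2 := ler_wpM2l (mulr_ge0 (ltW N_gt0) (p0 k)) a_ge.
  have h3 := ler_wpM2l (ler0n R v1) taup.
  lra.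
- have [a_ge d_ge] := outbid _ i21 bm.
  have h1 := mulr_ge0 tau0 d_ge.
  have h2 := rise_scaled (p0 k) a_ge.
  rewrite -/a in h2; lra.
- have [/existsP[j /andP[j1 mj]]|] := boolP [exists j, (j != i1) && (m < b j)%N].
    have [a_ge d_ge] := outbid _ j1 mj.
    have h1 := mulr_ge0 tau0 d_ge.
    have h2 := rise_scaled (p0 k) a_ge.
    rewrite -/a in h2; lra.
  move=> /existsPn nj.
  have bj j : j != i1 -> (b j <= m)%N.
    by move=> j1; have := nj j; rewrite j1 /= -leqNgt.
  (* Bidding [m.+1] wins alone, against at most half of [v1 - m] in a tie; the difference is at
     least [(v1 - m - 2) / 2], and [m_v1] makes this at least [1 / 2]. *)
  have d_ge : 2^-1 <= d.
    rewrite /d payoff_alone => [|j j1]; last by rewrite rebid_in rebid_out // ltnS bj.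
    have := @payoff_tied R N v i1 i2 (rebid b k) i21.
    rewrite !rebid_in rebid_out // bm leqnn => /(_ isT) /=.
    have : m.+3%:R <= v1%:R :> R by rewrite ler_nat.
    rewrite -!(natr1 m.+2) -!(natr1 m.+1) -!(natr1 m) /v1; lra.
  have a_ge : 0 <= a by apply: (@rise_gain_ge0 R N v i1 b k i2) => //=; rewrite bm.
  have h1 := ler_wpM2l tau0 d_ge.
  have h2 := mulr_ge0 (mulr_ge0 (ltW N_gt0) (p0 k)) a_ge.
  lra.
Qed.

(** Ties at [m] are left neutral for buyer 2, since buyer 1's [push] pays for them. A bid of buyer 1
    from [v2] on makes every response of buyer 2 worth 0, hence the indicators of [b i1 < v2]. *)
Lemma level2_gain x b : mixed_profile x ->
  x i2 0 l * ((m < b i1)%N && (b i1 < v2)%N)%:R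
  - C2 * x i2 0 l * (b i1 < m)%N%:R
  - C2 * prob x i2 (fun j => j < m)%N * (b i1 < v2)%N%:R
  <= dot (level2 (x i2)) (responses R i2 b).
Proof.
move=> xs; have [q0 _] := xs i2.
have [bv|bv] := leqP v2 (b i1).
  rewrite (responses_outbid R (j := i1)) //.
  have -> : (b i1 < m)%N = false by rewrite ltnNge (leq_trans _ bv) // ltnW // ltnW.
  by rewrite dotC dot0l andbF /= !mulr0 !subr0.
rewrite dotZl.
have := ler_wpM2l (ltW N_gt0) (dot_rise_responses_ge b l (xs i2)).
rewrite -/v2 -/(prob x i2 (fun j => j < m)%N).
set QL := prob x i2 _; have QL0 : 0 <= QL by exact: prob_ge0.
set a := \sum_(_ < _ | _) _.
set r := dot _ _.
rewrite mulrBr /C2.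
case: (ltngtP (b i1) m) => bm /=; rewrite ?(mulr1n, mulr1, mulr0n, mulr0, addr0, add0r).
- have a_ge : - v2%:R ^+ 2 <= a by exact: rise_gain_ge_opp.
  have h2 := ler_wpM2l (mulr_ge0 (ltW N_gt0) (q0 l)) a_ge.
  lra.
- have a_ge : N%:R^-1 <= a.
    have v2_gt0 : (0 < v2)%N by exact: leq_trans m_v2.
    have top : (v2.-1 < v2)%N by rewrite prednK.
    apply: (@rise_gain_ge R N v i2 b l (Ordinal top) i1) => //=.
      by rewrite -ltnS prednK.
    move=> h h1; rewrite -ltnS prednK //.
    by have [->//|/rival_lt] := eqVneq h i1.
  have h2 := rise_scaled (q0 l) a_ge.
  rewrite -/a in h2; lra.
- have a_ge : 0 <= a by apply: (@rise_gain_ge0 R N v i2 b l i1) => //=; rewrite bm.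
  have h2 := mulr_ge0 (mulr_ge0 (ltW N_gt0) (q0 l)) a_ge.
  lra.
Qed.

(* Buyer 2's low bids only count when buyer 1 bids below [v2]: otherwise buyer 2
   wins nothing whatever he bids, and his moves cannot eliminate anything. *)
Definition low_bids (s : nat) x : R :=
  prob x i1 (fun j => j < s)%N +
  prob x i2 (fun j => j < s)%N * prob x i1 (fun j => j < v2)%N.

Lemma level_gain x : mixed_profile x ->
  4^-1 * (low_bids m.+1 x - low_bids m x) - (C1 + C2 + 1) * low_bids m x
  <= dot (level1 (x i1)) (own_grad i1 x) + dot (level2 (x i2)) (own_grad i2 x).
Proof.
move=> xs; rewrite !dot_own_grad_responses //.
have H1 := ler_expect xs (fun b => level1_gain b xs).
have H2 := ler_expect xs (fun b => level2_gain b xs).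
apply: le_trans (lerD H1 H2) => {H1 H2}.
rewrite !(expectB, expectD, expectZ, expect_const) //.
rewrite (expect_prob i2 (pred1 m) xs) (expect_prob i2 (fun j => m < j)%N xs).
rewrite (expect_prob i2 (fun j => j < m)%N xs) (expect_prob i1 (fun j => j < m)%N xs).
rewrite (expect_prob i1 (fun j => (m < j) && (j < v2))%N xs).
rewrite (expect_prob i1 (fun j => j < v2)%N xs).
rewrite /low_bids !prob_ltS.
have Qsum : prob x i2 (fun j => j < m)%N + prob x i2 (pred1 m) +
    prob x i2 (fun j => m < j)%N = 1.
  by rewrite -(prob_trichotomy x i2 predT m); have [_] := xs i2.
have PV : prob x i1 (fun j => j < v2)%N = prob x i1 (fun j => j < m)%N +
    prob x i1 (pred1 m) + prob x i1 (fun j => (m < j) && (j < v2))%N.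
  rewrite (prob_trichotomy x i1 _ m); congr (_ + _ + _); apply: eq_prob => j /=; lia.
have Pk' : x i1 0 k' <= prob x i1 (fun j => (m < j) && (j < v2))%N.
  by rewrite -prob_point; apply: prob_le => // j _ /eqP -> /=; lia.
have Pk : prob x i1 (pred1 m) = x i1 0 k := prob_point x k.
have Ql : prob x i2 (pred1 m) = x i2 0 l := prob_point x l.
set tau := Num.max _ _.
have tau_ge : x i1 0 k - x i1 0 k' <= tau by rewrite le_max lexx orbT.
have := prob_ge0 i1 (fun j => j < m)%N xs.
have := prob_ge0 i1 (pred1 m) xs.
have := prob_ge0 i1 (fun j => (m < j) && (j < v2))%N xs.
have := prob_ge0 i2 (fun j => j < m)%N xs.
have := prob_ge0 i2 (pred1 m) xs.
have := prob_ge0 i2 (fun j => m < j)%N xs.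
rewrite PV -Ql {PV Ql}; move: tau tau_ge => tau.
rewrite -Pk {Pk}; move: Pk' Qsum.
move: (prob x i1 (fun j => j < m)%N) (prob x i1 (pred1 m)) (x i1 0 k')
  (prob x i1 (fun j => (m < j) && (j < v2))%N) => PL P P' PM.
move: (prob x i2 (fun j => j < m)%N) (prob x i2 (pred1 m))
  (prob x i2 (fun j => m < j)%N) => QL Q QM.
move=> P'M Qsum tauP QM0 Q0 QL0 PM0 P0 PL0.
have C20 : 0 <= C2 by rewrite mulr_ge0 ?sqr_ge0.
(* The gains are at least [(P - PM) * Q / 2 + P * QM + Q * PM], that is
   [P * Q / 2 + P * QM + Q * PM / 2]. The increment of [low_bids] is [P + Q * (PL + P + PM)] with
   [P] split by [PE]: it contains [P * Q] twice, whence the factor [1 / 4], and its terms in [QL] or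
   [PL] are charged to [low_bids m]. *)
have h1 : (P - PM) * Q <= tau * Q by rewrite ler_wpM2r //; lra.
have PE : P = P * QL + P * Q + P * QM by rewrite -!mulrDr Qsum mulr1.
have Q1 : Q <= 1 by lra.
have h2 : Q * PL <= PL by rewrite ler_piMl.
have h3 := mulr_ge0 C1_ge0 (mulr_ge0 QL0 PM0).
have h4 := mulr_ge0 C1_ge0 (mulr_ge0 QL0 PL0).
have h5 := ler_wpM2l C20 h2.
have h6 := mulr_ge0 P0 QM0.
have h7 := mulr_ge0 Q0 PM0.
have h8 := mulr_ge0 P0 Q0.
have h9 := mulr_ge0 P0 QL0.
have h10 := mulr_ge0 QL0 PM0.
have h11 := mulr_ge0 QL0 PL0.
have h12 := mulr_ge0 Q0 PL0.
lra.
Qed.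

End Level.

Definition eliminable (w : profile R v -> R) : Prop :=
  exists G1 G2, [/\ tangential_field G1, tangential_field G2 &
    forall x, mixed_profile x ->
      w x <= dot (G1 (x i1)) (own_grad i1 x) + dot (G2 (x i2)) (own_grad i2 x)].

Lemma eliminable_comb (w1 w2 w : profile R v -> R) (c1 c2 : R) :
  0 <= c1 -> 0 <= c2 -> eliminable w1 -> eliminable w2 ->
  (forall x, mixed_profile x -> w x <= c1 * w1 x + c2 * w2 x) -> eliminable w.
Proof.
move=> c10 c20 [F1 [F2 [tF1 tF2 HF]]] [G1 [G2 [tG1 tG2 HG]]] Hw.
exists (fun p => c1 *: F1 p + c2 *: G1 p), (fun p => c1 *: F2 p + c2 *: G2 p).
split; [by apply: tangential_fieldD; exact: tangential_fieldZ
       |by apply: tangential_fieldD; exact: tangential_fieldZ |].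
move=> x xs; rewrite !dotDl !dotZl addrACA -!mulrDr (le_trans (Hw x xs)) //.
by rewrite lerD // ler_wpM2l ?HF ?HG.
Qed.

Lemma eliminable_low_bids (s : nat) : (s < v2)%N -> (s.+1 < v1)%N ->
  eliminable (low_bids s).
Proof.
elim: s => [_ _|m IH mv2 mv1].
  exists (fun=> 0), (fun=> 0); split; try exact: tangential_field0.
  move=> x xs; have p0 i : prob x i (fun j => j < 0)%N = 0 by rewrite /prob big_pred0.
  by rewrite !dot0l /low_bids !p0 mul0r.
have mv2' : (m < v2)%N := ltnW mv2.
have low : eliminable (low_bids m) by apply: IH => //; exact: ltnW.
pose C : R := N%:R * v1%:R ^+ 2 + v1%:R + N%:R * v2%:R ^+ 2 + 1.
have lev : eliminable (fun x =>
    4^-1 * (low_bids m.+1 x - low_bids m x) - C * low_bids m x).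
  exists (level1 mv1), (level2 mv2); split; last exact: level_gain.
    apply: tangential_fieldD; last first.
      by apply: tangential_field_push; rewrite -val_eqE /=; lia.
    exact/tangential_fieldZ/tangential_field_rise.
  exact/tangential_fieldZ/tangential_field_rise.
(* Four times the new inequality leaves a deficit of [(4 * C + 1) * low_bids m], which the lower
   levels supply. *)
apply: (eliminable_comb (c1 := 4) (c2 := 4 * C + 1) _ _ lev low) => //.
  by rewrite !addr_ge0 ?mulr_ge0 ?addr_ge0 ?mulr_ge0 ?sqr_ge0.
by move=> x xs; lra.
Qed.

(** * Aiming at [v2] when [v1 > v2 + 1] *)

Section Aim.
Hypothesis v21' : (v2.+1 < v1)%N.

Let c : 'I_v1 := Ordinal (ltnW v21').

(** Bidding [v2] surely wins [v1 - v2]. This beats any higher bid by at least 1, and beats [v2 - 1]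
    by at least [1 / 2] when buyer 2 also bids [v2 - 1]. The other cases lose at most [v1] and are
    charged to the negative terms. *)
Lemma aim_gain x b : mixed_profile x ->
  2^-1 * prob x i1 (predC1 v2) - (v1%:R + 1) * prob x i1 (fun j => j.+1 < v2)%N
  - (v1%:R + 1) * prob x i1 (fun j => j.+1 == v2) * ((b i2).+1 < v2)%N%:R
  <= dot (aim c (x i1)) (responses R i1 b).
Proof.
move=> xs; have [p0 _] := xs i1.
rewrite (dot_aim _ _ (xs i1)) !probE [_ * _ * _]mulrAC !mulr_sumr -!sumrB; apply: ler_sum => j _.
set u := responses R i1 b.
have -> : predC1 v2 j = (j != v2 :> nat) by [].
rewrite [leLHS](_ : _ = x i1 0 j * (2^-1 * (j != v2 :> nat)%:R -
  (v1%:R + 1) * (j.+1 < v2)%N%:R -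
  (v1%:R + 1) * ((b i2).+1 < v2)%N%:R * (j.+1 == v2)%:R)); last by ring.
apply: ler_wpM2l => //.
have uj : u 0 j <= v1%:R - j%:R by rewrite mxE (le_trans (payoff_le _ _ _)) // rebid_in.
have uc : u 0 c = v1%:R - v2%:R.
  by rewrite mxE payoff_alone => [|h h1]; rewrite rebid_in // rebid_out // rival_lt.
have vj : j%:R <= v1%:R :> R by rewrite ler_nat ltnW.
have v0 : 0 <= v1%:R - v2%:R :> R by rewrite subr_ge0 ler_nat.
have v2' : v2%:R + 2 <= v1%:R :> R by rewrite -natrD ler_nat addn2.
have j0 := ler0n R j.
have [jv|vj'] := ltnP j.+1 v2.
  have -> : (j.+1 == v2) = false by apply/negbTE; rewrite neq_ltn jv.
  have -> : (j != v2 :> nat) by rewrite neq_ltn (ltnW jv).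
  by rewrite uc mulr0 subr0 !mulr1; lra.
case: (ltngtP j v2) => [jv|jv|jv].
- have jE : j.+1 == v2 by rewrite eqn_leq jv.
  rewrite jE uc !mulr1 mulr0 subr0.
  have [bv|bv] := ltnP (b i2).+1 v2; first by rewrite mulr1; lra.
  have := @payoff_tied R N v i1 i2 (rebid b j) i21.
  rewrite rebid_in rebid_out // => tie.
  have {}tie := tie (ltac:(rewrite -ltnS (eqP jE); exact: bv)).
  have : j%:R + 1 = v2%:R :> R by rewrite natr1 (eqP jE).
  by rewrite mulr0 subr0 [u 0 j]mxE -/v1; lra.
- have -> : (j.+1 == v2) = false by apply/negbTE; rewrite neq_ltn ltnS (ltnW jv) orbT.
  have : v2%:R + 1 <= j%:R :> R by rewrite natr1 ler_nat.
  by rewrite uc !mulr0 !subr0 mulr1; lra.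
- have -> : (j.+1 == v2) = false by apply/negbTE; rewrite jv neq_ltn ltnSn orbT.
  have -> : j = c by exact: val_inj.
  by rewrite !mulr0 !subr0 subrr.
Qed.

(** Both error terms of [aim_gain] are covered by [low_bids v2.-1]: the first by buyer 1's low bids,
    the second by the product term, since [v2 - 1] lies below [v2]. *)
Lemma eliminable_not_second : (0 < v2)%N ->
  eliminable (fun x => prob x i1 (predC1 v2)).
Proof.
move=> v2_gt0.
have low : eliminable (low_bids v2.-1) by apply: eliminable_low_bids; lia.
have top : eliminable (fun x =>
    2^-1 * prob x i1 (predC1 v2) - (v1%:R + 1) * low_bids v2.-1 x).
  exists (aim c), (fun=> 0); split; first exact: tangential_field_aim.
    exact: tangential_field0.
  move=> x xs; rewrite dot0l addr0 dot_own_grad_responses //.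
  apply: le_trans (ler_expect xs (fun b => aim_gain b xs)).
  rewrite !(expectB, expectZ, expect_const) //.
  rewrite (expect_prob i2 (fun j => j.+1 < v2)%N xs) /low_bids.
  have ltE i : prob x i (fun j => j < v2.-1)%N = prob x i (fun j => j.+1 < v2)%N.
    by apply: eq_prob => j; lia.
  have le_v2 : prob x i1 (fun j => j.+1 == v2) <= prob x i1 (fun j => j < v2)%N.
    by apply: prob_le => // j; lia.
  rewrite !ltE mulrDr opprD addrA lerD2l lerN2 -mulrA ler_wpM2l ?addr_ge0 //.
  by rewrite mulrC ler_wpM2l // prob_ge0.
apply: (eliminable_comb (c1 := 2) (c2 := 2 * (v1%:R + 1)) _ _ top low) => //.
by move=> x xs; lra.
Qed.

End Aim.

Lemma eliminable_eliminated : (0 < v2)%N ->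
  eliminable (fun x => prob x i1 (eliminated v1 v2)).
Proof.
move=> v2_gt0; have [v12|v12] := ltnP v2.+1 v1.
  have [G1 [G2 [t1 t2 H]]] := eliminable_not_second v12 v2_gt0.
  exists G1, G2; split=> // x xs; rewrite (@eq_prob _ _ _ _ _ _ (predC1 v2)) ?H //.
  by move=> j; rewrite /eliminated /=; case: ifP => //; lia.
have elimE j : eliminated v1 v2 j = (j < v2 - 2)%N.
  by rewrite /eliminated ifT; lia.
(* Subtraction is truncated: for [v2 <= 2] the set is empty and the zero fields suffice. *)
have [s0|s_gt0] := posnP (v2 - 2).
  exists (fun=> 0), (fun=> 0); split; try exact: tangential_field0.
  by move=> x xs; rewrite !dot0l addr0 /prob big_pred0 // => j; rewrite elimE s0.
have [||G1 [G2 [t1 t2 H]]] := @eliminable_low_bids (v2 - 2); try lia.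
exists G1, G2; split=> // x xs; apply: le_trans (H x xs).
by rewrite (eq_prob _ _ elimE) lerDl mulr_ge0 ?prob_ge0.
Qed.

End Elimination.

Theorem theorem5p1 (R : realType) (N : nat) (hN : (2 <= N)%N) (v : 'I_N -> nat)
    (v_gt0 : forall i, (0 < v i)%N)
    (v_noninc : forall i j : 'I_N, (i <= j)%N -> (v j <= v i)%N)
    (v1_ge2 : (2 <= v (buyer1 hN))%N) :
  let i1 := buyer1 hN in
  let i2 := buyer2 hN in
  (exists (h1 : 'rV[R]_(v i1) -> R) (h2 : 'rV[R]_(v i2) -> R),
    [/\ lipschitz_differentiable h1, tangential h1,
        lipschitz_differentiable h2, tangential h2 &
        forall x : profile R v, mixed_profile x ->
          \sum_(b1 < v i1 | eliminated (v i1) (v i2) b1) x i1 0 b1 <=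
          dot (grad h1 (x i1)) (own_grad i1 x) +
          dot (grad h2 (x i2)) (own_grad i2 x)]) /\
  (forall (eta1 eta2 : nat -> nat -> R) (x : nat -> nat -> profile R v),
    admissible_step_sizes eta1 -> admissible_step_sizes eta2 ->
    (forall T t, (1 <= t <= T)%N -> mixed_profile (x T t)) ->
    (forall T, online_gradient_ascent i1 T (eta1 T) (x T)) ->
    (forall T, online_gradient_ascent i2 T (eta2 T) (x T)) ->
    (fun T => T%:R^-1%R * \sum_(1 <= t < T.+1)
        \sum_(b1 < v i1 | ~~ near_second_value (v i2) b1) x T t i1 0 b1 : R)
      =o_\oo (fun=> 1 : R)).
Proof.
move=> i1 i2.
have [G1 [G2 [[h1 hG1] [h2 hG2] HG]]] := @eliminable_eliminated R N hN v v_noninc (v_gt0 _).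
split.
  exists h1, h2; split.
  - exact: smooth_lipschitz_differentiable hG1.1.
  - exact: tangential_potential_tangential hG1.
  - exact: smooth_lipschitz_differentiable hG2.1.
  - exact: tangential_potential_tangential hG2.
  - by move=> x xs; rewrite (smooth_grad hG1.1) (smooth_grad hG2.1); exact: HG.
move=> eta1 eta2 x [e1_gt0 e1_mon e1_inv e1_sum] [e2_gt0 e2_mon e2_inv e2_sum] xs oga1 oga2.
have [C1 C10 reg1] := regret_bound hG1.
have [C2 C20 reg2] := regret_bound hG2.
pose far (T t : nat) : R := prob (x T t) i1 (fun j => ~~ near_second_value (v i2) j).
have far_le T : (0 < T)%N -> \sum_(1 <= t < T.+1) far T t <=
    1 + C1 * ((eta1 T T)^-1 + \sum_(1 <= t < T.+1) eta1 T t)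
      + C2 * ((eta2 T T)^-1 + \sum_(1 <= t < T.+1) eta2 T t).
  (* The last period lies outside the regret sum and is bounded by 1. *)
  move=> T0; rewrite big_nat_recr //= addrC -addrA lerD //.
    by apply: prob_le1; apply: xs; rewrite T0 leqnn.
  have := reg1 T (eta1 T) (x T) T0 (e1_gt0 T) (e1_mon T) (xs T) (oga1 T).
  have := reg2 T (eta2 T) (x T) T0 (e2_gt0 T) (e2_mon T) (xs T) (oga2 T).
  move=> r2 r1; apply: le_trans (lerD r1 r2); rewrite -big_split /=.
  rewrite big_nat [leRHS]big_nat; apply: ler_sum => t /andP[t1 tT].
  have xst : mixed_profile (x T t) by apply: xs; rewrite t1 ltnW.
  apply: le_trans (HG _ xst); apply: prob_le => // j jv.
  move: jv; rewrite /near_second_value /eliminated -/i1 -/i2.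
  (* When [v1] is [v2] or [v2 + 1], bids are at most [v2], so a bid that is not near [v2] lies below
     [v2 - 2]. *)
  by move: (v i1) (v i2) => w1 w2 jw; case: ifP; lia.
apply/eqoP => e e0.
(* The constant 1, the two inverse step sizes and the two step sums will each be at most [d * T],
   for a total of [e * T]. *)
pose d := e / (1 + 2 * (C1 + C2)).
have C0 : 0 < 1 + 2 * (C1 + C2) by rewrite ltr_wpDr ?mulr_ge0 ?addr_ge0.
have d0 : 0 < d by rewrite divr_gt0.
near=> T.
have T0 : (0 < T)%N by near: T; exact: nbhs_infty_gt.
have Tr0 : 0 < T%:R :> R by rewrite ltr0n.
have T1 : 1 <= d * T%:R.
  rewrite mulrC -ler_pdivrMr // mul1r.
  by near: T; exact: nbhs_infty_ger.
have small (f : nat -> R) : `|f T| <= d * `|T%:R : R| -> f T <= d * T%:R.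
  by rewrite [`|T%:R|]ger0_norm // => /(le_trans (ler_norm _)).
have a1 : (eta1 T T)^-1 <= d * T%:R.
  by apply: (small (fun T => (eta1 T T)^-1)); near: T; move/eqoP: e1_inv => /(_ _ d0).
have a2 : (eta2 T T)^-1 <= d * T%:R.
  by apply: (small (fun T => (eta2 T T)^-1)); near: T; move/eqoP: e2_inv => /(_ _ d0).
have s1 : \sum_(1 <= t < T.+1) eta1 T t <= d * T%:R.
  apply: (small (fun T => \sum_(1 <= t < T.+1) eta1 T t)); near: T.
  by move/eqoP: e1_sum => /(_ _ d0).
have s2 : \sum_(1 <= t < T.+1) eta2 T t <= d * T%:R.
  apply: (small (fun T => \sum_(1 <= t < T.+1) eta2 T t)); near: T.
  by move/eqoP: e2_sum => /(_ _ d0).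
have far_ge0 : 0 <= \sum_(1 <= t < T.+1) far T t.
  by rewrite big_nat sumr_ge0 // => t tT; apply: prob_ge0; exact: xs.
rewrite normr1 mulr1 ger0_norm ?mulr_ge0 ?invr_ge0 //.
rewrite mulrC ler_pdivrMr //.
apply: (le_trans (far_le T T0)).
have -> : e = (1 + 2 * (C1 + C2)) * d by rewrite /d mulrC divfK // gt_eqF.
have := ler_wpM2l C10 (lerD a1 s1); have := ler_wpM2l C20 (lerD a2 s2).
lra.
Unshelve. all: by end_near. Qed.
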